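(* Let $N_{\mathrm{comb}}$ be the (abstract) integrated density of states of the $\mathbb{Z}^2$-periodic combinatorial Laplacian $\Delta_{\mathrm{comb}}$ of the Kagome lattice, $$N_{\mathrm{comb}}(\mu)=\frac{1}{|Q|}\,\mathrm{tr}\big[\mathbf 1_QP_{\mathrm{comb}}((-\infty,\mu])\big],$$ where $\mathrm{tr}$ is the trace on $\ell^2(V)$ and $P_{\mathrm{comb}}$ denotes the spectral projection of $\Delta_{\mathrm{comb}}$. Then $N_{\mathrm{comb}}$ vanishes on $(-\infty,0]$, is continuous on $\mathbb{R}\setminus\{3/2\}$ and has a jump of size $1/3$ at $\mu=3/2$. Moreover, $N_{\mathrm{comb}}$ is strictly monotone increasing on $[0,3/2]$ and $N_{\mathrm{comb}}(\mu)=1$ for $\mu\ge3/2$.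
   Context: Let $w_1=1$, $w_2=e^{\pi i/3}\in\mathbb{C}$. The Kagome lattice has vertex set $$V=(2\mathbb{Z}w_1+2\mathbb{Z}w_2)\ \sqcup\ (w_1+2\mathbb{Z}w_1+2\mathbb{Z}w_2)\ \sqcup\ (w_2+2\mathbb{Z}w_1+2\mathbb{Z}w_2)\subset\mathbb{C},$$ and $v_1,v_2\in V$ are adjacent, $v_1\sim v_2$, iff $|v_1-v_2|=1$; every vertex has degree $4$. The combinatorial Laplacian is the bounded self-adjoint operator on $\ell^2(V)$ given by $(\Delta_{\mathrm{comb}}F)(v)=\frac{1}{\deg v}\sum_{w\sim v}(F(v)-F(w))$. The group $\mathbb{Z}^2$ acts on $V$ by $T_\gamma(x)=2\gamma_1w_1+2\gamma_2w_2+x$, and $Q$ is a combinatorial fundamental domain for this action, consisting of three vertices, one from each orbit (e.g. $\{0,w_1,w_2\}$; the value of $N_{\mathrm{comb}}$ does not depend on the choice). $\mathbf 1_Q$ is multiplication by the indicator function of $Q$. *)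

(* Defs.v *)
From mathcomp Require Import all_boot all_order all_algebra finmap.
From mathcomp Require Import all_classical all_reals all_analysis.
From mathcomp Require Import complex.

Set Implicit Arguments.
Unset Strict Implicit.
Unset Printing Implicit Defensive.

Import Order.TTheory GRing.Theory Num.Theory.
Import numFieldNormedType.Exports.

Local Open Scope classical_set_scope.
Local Open Scope ring_scope.

(** * The Hilbert space ell^2(T) *)

(* ell^2(T) is handled as a predicate on functions T -> R[i]; operators on
   ell^2(T) are maps of functions, only their values on ell^2(T) matter. *)
Definition sqnorm (R : realType) (T : choiceType) (F : T -> R[i]) : \bar R :=
  (\esum_(t in [set: T]) (complex.Re (`|F t| ^+ 2))%:E)%E.

Definition ell2 (R : realType) (T : choiceType) : set (T -> R[i]) :=
  [set F | (sqnorm F < +oo)%E].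

(* Unconditional sums; meaningful for absolutely summable families. *)
Definition rsum (R : realType) (T : choiceType) (f : T -> R) : R :=
  fine (\esum_(t in [set: T]) (Num.max (f t) 0)%:E)%E -
  fine (\esum_(t in [set: T]) (Num.max (- f t) 0)%:E)%E.

Definition csum (R : realType) (T : choiceType) (f : T -> R[i]) : R[i] :=
  (rsum (fun t => complex.Re (f t)) +i* rsum (fun t => complex.Im (f t)))%C.

Definition inner (R : realType) (T : choiceType) (F G : T -> R[i]) : R[i] :=
  csum (fun t => (F t)^*%C * G t).

(* The trace is computed in the orthonormal basis of point masses. *)
Definition trace (R : realType) (T : choiceType)
    (A : (T -> R[i]) -> T -> R[i]) : R[i] :=
  csum (fun t : T => inner (\1_[set t]) (A (\1_[set t]))).

Definition mul_indic (R : realType) (T : choiceType) (Q : set T)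
  (F : T -> R[i]) : T -> R[i] := fun t => \1_Q t * F t.

(** * Spectral projections *)

Record is_orth_proj (R : realType) (T : choiceType)
    (A : (T -> R[i]) -> T -> R[i]) : Prop := IsOrthProj {
  orth_proj_ell2 : forall F, ell2 F -> ell2 (A F);
  orth_proj_linear : forall (a : R[i]) F G, ell2 F -> ell2 G ->
    A (fun t => a * F t + G t) = (fun t => a * A F t + A G t);
  orth_proj_idem : forall F, ell2 F -> A (A F) = A F;
  orth_proj_adj : forall F G, ell2 F -> ell2 G ->
    inner F (A G) = inner (A F) G }.

(* Projection-valued Borel measures on the real line with bounded support. *)
Record is_bounded_pvm (R : realType) (T : choiceType)
    (P : set R -> (T -> R[i]) -> T -> R[i]) : Prop := IsBoundedPVM {
  pvm_orth_proj : forall B, measurable B -> is_orth_proj (P B);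
  pvm_set0 : forall F, ell2 F -> P set0 F = (fun=> 0);
  pvm_setT : forall F, ell2 F -> P setT F = F;
  pvm_bounded : exists a : R, forall F, ell2 F -> P `[- a, a]%classic F = F;
  pvm_setI : forall B C F, measurable B -> measurable C -> ell2 F ->
    P (B `&` C) F = P B (P C F);
  pvm_sigma_additive : forall (B : (set R)^nat) F,
    (forall n, measurable (B n)) -> trivIset setT B -> ell2 F ->
    sqnorm (fun t => P (\bigcup_n B n) F t - \sum_(k < n) P (B k) F t)
      @[n --> \oo] --> 0%E }.

(* P is the spectral measure of the bounded self-adjoint operator A:
   (F, A F) is the integral of lambda against the measure
   B |-> (F, P B F), for all F in ell^2(T).  By the spectral theorem
   every such A has a spectral measure, unique on Borel sets and ell^2(T). *)
Definition is_spectral_measure (R : realType) (T : choiceType)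
    (A : (T -> R[i]) -> T -> R[i])
    (P : set R -> (T -> R[i]) -> T -> R[i]) : Prop :=
  is_bounded_pvm P /\
  forall F, ell2 F ->
    inner F (A F) =
    (fine (integral (fun B : set R => (complex.Re (inner F (P B F)))%:E)
            setT (fun lambda : R => lambda%:E)))%:C%C.

(** * The Kagome lattice *)

Definition w1 (R : realType) : R[i] := 1.

(* exp (pi i / 3) *)
Definition w2 (R : realType) : R[i] := (cos (pi / 3) +i* sin (pi / 3))%C.

Definition translate (R : realType) (g : int * int) (x : R[i]) : R[i] :=
  2 * g.1%:~R * w1 R + 2 * g.2%:~R * w2 R + x.

Definition kagome (R : realType) : set R[i] :=
  range (fun g => translate g 0) `|`
  range (fun g => translate g (w1 R)) `|`
  range (fun g => translate g (w2 R)).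

Arguments kagome : clear implicits.

Definition nbrs (R : realType) (v : kagome R) : set (kagome R) :=
  [set w : kagome R | `|val v - val w| = 1].

Definition deg (R : realType) (v : kagome R) : nat :=
  #|` fset_set (nbrs v)|%fset.

Definition laplacian (R : realType) (F : kagome R -> R[i]) : kagome R -> R[i] :=
  fun v => (deg v)%:R^-1 * \sum_(w \in nbrs v) (F v - F w).

Definition fundamental_domain (R : realType) (Q : set (kagome R)) : Prop :=
  forall v : kagome R,
    exists! q : kagome R, Q q /\ exists g : int * int, val v = translate g (val q).

(** * The integrated density of states *)

(* The trace below is a nonnegative real: it is the sum over v in Q of
   (delta_v, P delta_v) = ||P delta_v||^2. *)
Definition ids (R : realType) (Q : set (kagome R))
    (P : set R -> (kagome R -> R[i]) -> kagome R -> R[i]) (mu : R) : R :=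
  (#|` fset_set Q|%fset)%:R^-1 *
  complex.Re (trace (fun F => mul_indic Q (P `]-oo, mu]%classic F))).

Definition has_jump (R : realType) (N : R -> R) (mu s : R) : Prop :=
  exists l r : R, [/\ N x @[x --> mu^'-] --> l,
                      N x @[x --> mu^'+] --> r & r - l = s].

(* Main.v *)
(**
The lattice is the line graph of the hexagonal lattice: with the rotations u
and d of the up- and down-pointing triangles, Delta F = F - (F u + F u^2 + F d
+ F d^2) / 4 = 3/2 F - (U F + D F) / 4, where U and D (sums over triangles)
are positive and at most 3; hence 0 <= Delta <= 3/2.

A translation T commutes with Delta, and b^n |P(]b,oo[) T F| <= a^n |F| for F
in the range of P(]-oo,a]) and a < b; so the spectral distribution functions
mu |-> (delta_v, P(]-oo,mu]) delta_v) are translation invariant.  They are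
right continuous, with jump (delta_v, P({mu}) delta_v), and P({mu}) projects
onto the eigenspace of mu.

The jumps are computed by the argument of Delyon and Souillard.  The trace of
P({mu}) over an n x n box of cells is n^2 times the jump per cell, and at most
the number of values which determine an eigenfunction on the box.  For
mu <> 3/2 these are O(n) boundary values, so there is no jump.  For mu = 3/2
an eigenfunction has zero sum over every triangle: n^2 + O(n) values determine
it, and among the 3 n^2 functions supported in the box there are only
2 n^2 + O(n) constraints, so the jump per cell is exactly 1.

If the distribution were constant on ]x,y] inside [0,3/2], then, by invariance,
P(]x,y]) would vanish, and |(Delta - c) F| >= (y - x)/2 |F| for the midpoint c
of ]x,y].  A plane wave with energy c truncated to an n x n box contradicts
this, as its squared norm is of order n^2 and (Delta - c) F lives on the
boundary.
*)
Require Import Defs.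
From HB Require Import structures.
From mathcomp Require Import all_boot all_order all_algebra finmap.
From mathcomp Require Import all_classical all_reals all_analysis.
From mathcomp Require Import complex measurable_realfun.
From mathcomp Require Import ring lra zify.

Set Implicit Arguments.
Unset Strict Implicit.
Unset Printing Implicit Defensive.

Import Order.TTheory GRing.Theory Num.Theory.
Import numFieldNormedType.Exports.
Local Open Scope classical_set_scope.
Local Open Scope ring_scope.

(** * Square-summable functions *)

(** The hypothesis on [P] gives only the quadratic form (F, A F) as an integral, so neither a
    functional calculus nor the uniqueness of the spectral measure is invoked: everything is drawn
    from bounds b |F|^2 <= (F, A F) <= b' |F|^2 on ranges of projections. Even the commutation of
    [P B] with [A] has to be derived, from the additivity of the spectral distributions of functions
    living over disjoint sets. Uniqueness would yield translation invariance at once; here the range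
    of P(]-oo, a]) is instead recognised by the growth of the iterates of [A]. Only norms and
    diagonal values of symmetric operators enter, so the real part of the scalar product suffices.
    The decomposition into 3 x 3 Bloch matrices is needed only along one line of quasi-momenta,
    where two bands already attain every energy in ]0, 3/2[; strict monotonicity asks for a single
    wave per energy. *)

Section Rsum.
Context {R : realType} {T : choiceType}.
Implicit Types f g : T -> R.

Let sm f := summable [set: T] (EFin \o f).

Lemma summable_le f g : (forall t, `|f t| <= g t) -> sm g -> sm f.
Proof.
move=> fg; apply: le_lt_trans; apply: le_esum => t _ /=.
by rewrite lee_fin (le_trans (fg t))// ler_norm.
Qed.

Lemma summable_add f g : sm f -> sm g -> sm (fun t => f t + g t).
Proof. exact: summableD. Qed.

Lemma summable_scale a f : sm f -> sm (fun t => a * f t).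
Proof.
move=> sf; suff : sm (fun t => `|a| * `|f t|).
  by apply: summable_le => t; rewrite normrM.
have a1 : 0 <= `|a| by [].
have h n : sm (fun t => n%:R * `|f t|).
  elim: n => [|n IH].
    rewrite /sm /summable esum1 ?ltry// => t _ /=.
    by rewrite mul0r normr0.
  have -> : (fun t => n.+1%:R * `|f t|) = (fun t => n%:R * `|f t| + `|f t|).
    by apply/funext => t; rewrite -natr1 mulrDl mul1r.
  apply: summable_add => //; move: sf; apply: le_lt_trans.
  by apply: le_esum => t _ /=; rewrite normr_id.
apply: (@summable_le _ _ _ (h (Num.bound `|a|))) => t.
by rewrite ger0_norm ?mulr_ge0// ler_wpM2r// ltW// archi_boundP.
Qed.

Lemma esum_fin f : (forall t, 0 <= f t) -> sm f ->
  (\esum_(t in [set: T]) (f t)%:E)%E \is a fin_num.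
Proof.
move=> f0; rewrite /sm summableE; congr (_ \is a fin_num).
by apply: eq_esum => t _ /=; rewrite ger0_norm.
Qed.

(** Any splitting into a difference of nonnegative summable functions computes [rsum], not only the
    one into positive and negative parts; additivity rests on this freedom. *)
Lemma rsumB f g : sm f -> sm g -> (forall t, 0 <= f t) -> (forall t, 0 <= g t) ->
  rsum (fun t => f t - g t) =
  fine (\esum_(t in [set: T]) (f t)%:E)%E -
  fine (\esum_(t in [set: T]) (g t)%:E)%E.
Proof.
move=> sf sg f0 g0; rewrite /rsum.
have fin h : sm h -> (forall t, 0 <= h t) ->
    (\esum_(t in [set: T]) (h t)%:E)%E \is a fin_num by move=> ? ?; exact: esum_fin.
have sp : sm (fun t => Num.max (f t - g t) 0).
  apply: (summable_le _ (summable_add sf sg)) => t.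
  rewrite ger0_norm ?le_max ?lexx ?orbT// ge_max.
  by rewrite addr_ge0// andbT lerD2l (le_trans _ (g0 t))// oppr_le0.
have sn : sm (fun t => Num.max (- (f t - g t)) 0).
  apply: (summable_le _ (summable_add sf sg)) => t.
  rewrite ger0_norm ?le_max ?lexx ?orbT// ge_max.
  by rewrite addr_ge0// andbT opprB addrC lerD2r (le_trans _ (f0 t))// oppr_le0.
have mx0 (x : R) : 0 <= Num.max x 0 by rewrite le_max lexx orbT.
rewrite -!fineB ?fin//.
have := @esumB R T [set: T] (EFin \o f) (EFin \o g) sf sg.
rewrite /= => <-; last 2 first.
- by move=> t _; rewrite lee_fin.
- by move=> t _; rewrite lee_fin.
congr (fine (_ - _)%E); apply: eq_esum => t _.
  by rewrite funeposE /= EFin_max.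
by rewrite funenegE /= EFin_max.
Qed.

Let pos f t := Num.max (f t) 0.
Let neg f t := Num.max (- f t) 0.

Let pos_ge0 f t : 0 <= pos f t. Proof. by rewrite le_max lexx orbT. Qed.
Let neg_ge0 f t : 0 <= neg f t. Proof. by rewrite le_max lexx orbT. Qed.

Let posBneg f t : f t = pos f t - neg f t.
Proof.
rewrite /pos /neg; have [h|h] := leP (f t) 0.
  by rewrite max_l ?oppr_ge0// sub0r opprK.
by rewrite max_r ?subr0// oppr_le0 ltW.
Qed.

Let summable_abs f : sm f -> sm (fun t => `|f t|).
Proof.
by apply: le_lt_trans; apply: le_esum => t _ /=; rewrite normr_id.
Qed.

Let sm_pos f : sm f -> sm (pos f).
Proof.
move=> sf; apply: (summable_le _ (summable_abs sf)) => t.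
by rewrite ger0_norm// ge_max ler_norm normr_ge0.
Qed.

Let sm_neg f : sm f -> sm (neg f).
Proof.
move=> sf; apply: (summable_le _ (summable_abs sf)) => t.
by rewrite ger0_norm// ge_max -normrN ler_norm normr_ge0.
Qed.

Lemma rsumD f g : sm f -> sm g ->
  rsum (fun t => f t + g t) = rsum f + rsum g.
Proof.
move=> sf sg.
have -> : (fun t => f t + g t) =
    (fun t => (pos f t + pos g t) - (neg f t + neg g t)).
  by apply/funext => t; rewrite {1}(posBneg f t) {1}(posBneg g t); ring.
rewrite rsumB//; try by move=> t; rewrite addr_ge0.
- rewrite /rsum.
  have D (h k : T -> R) : sm h -> sm k -> (forall t, 0 <= h t) ->
      (forall t, 0 <= k t) ->
      fine (\esum_(t in [set: T]) (h t + k t)%:E)%E =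
      fine (\esum_(t in [set: T]) (h t)%:E)%E +
      fine (\esum_(t in [set: T]) (k t)%:E)%E.
    move=> sh sk h0 k0; rewrite -fineD ?esum_fin// -esumD//.
      by move=> t _; rewrite lee_fin.
    by move=> t _; rewrite lee_fin.
  rewrite !D//; try exact: sm_pos; try exact: sm_neg.
  by rewrite /pos /neg; ring.
- by apply: summable_add; exact: sm_pos.
- by apply: summable_add; exact: sm_neg.
Qed.

Lemma rsum_ge0E f : (forall t, 0 <= f t) ->
  rsum f = fine (\esum_(t in [set: T]) (f t)%:E)%E.
Proof.
move=> f0; rewrite /rsum [X in _ - X](_ : _ = 0) ?subr0.
  by congr fine; apply: eq_esum => t _; rewrite max_l.
by rewrite esum1// => t _; rewrite max_r// oppr_le0.
Qed.

Lemma rsum_ge0 f : (forall t, 0 <= f t) -> 0 <= rsum f.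
Proof.
move=> f0; rewrite rsum_ge0E// fine_ge0// esum_ge0// => t _.
by rewrite lee_fin.
Qed.

Lemma rsumN f : rsum (fun t => - f t) = - rsum f.
Proof.
by rewrite /rsum opprB; under [X in _ - fine X]eq_esum do rewrite opprK.
Qed.

Lemma rsum0 : rsum (fun _ : T => 0 : R) = 0.
Proof. by rewrite rsum_ge0E// esum1. Qed.

Let rsumZ_le b f : 0 <= b -> (forall t, 0 <= f t) -> sm f ->
  rsum (fun t => b * f t) <= b * rsum f.
Proof.
move=> b0 f0 sf; rewrite !rsum_ge0E//; last by move=> t; rewrite mulr_ge0.
rewrite -lee_fin EFinM !fineK ?esum_fin//; last 2 first.
- by move=> t; rewrite mulr_ge0.
- exact: summable_scale.
apply: ge_ereal_sup => _ [A [finA AT] <-].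
rewrite [leLHS](_ : _ = (b%:E * \sum_(t \in A) (f t)%:E)%E); last first.
  by rewrite ge0_mule_fsumr// => t; rewrite lee_fin.
rewrite lee_wpmul2l ?lee_fin//; apply: ereal_sup_ubound.
by exists A.
Qed.

Lemma rsumZ a f : sm f -> rsum (fun t => a * f t) = a * rsum f.
Proof.
move=> sf.
have Z b g : 0 <= b -> (forall t, 0 <= g t) -> sm g ->
    rsum (fun t => b * g t) = b * rsum g.
  move=> + g0 sg; rewrite le_eqVlt => /predU1P[<-|b0].
    rewrite mul0r [X in rsum X](_ : _ = fun=> 0) ?rsum0//.
    by apply/funext => t; rewrite mul0r.
  apply/eqP; rewrite eq_le rsumZ_le ?(ltW b0)//=.
  (* The converse inequality is [rsumZ_le] for the factor b^-1 and the function b g. *)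
  rewrite -ler_pdivlMl// (le_trans _ (rsumZ_le _ _ _))//.
  - rewrite [X in _ <= rsum X](_ : _ = g)//.
    by apply/funext => t; rewrite mulrA mulVf ?mul1r// gt_eqF.
  - by rewrite invr_ge0 ltW.
  - by move=> t; rewrite mulr_ge0// ltW.
  - exact: summable_scale.
wlog a0 : a / 0 <= a => [wl|].
  have [|/ltW a0] := leP 0 a; first exact: wl.
  have := wl (- a); rewrite oppr_ge0 => /(_ a0); rewrite mulNr => e; apply: oppr_inj; rewrite -e -rsumN.
  by congr rsum; apply/funext => t; rewrite mulNr.
have [sp sn] := (sm_pos sf, sm_neg sf).
have -> : (fun t => a * f t) = (fun t => a * pos f t + - (a * neg f t)).
  by apply/funext => t; rewrite {1}(posBneg f t) mulrBr.
rewrite rsumD ?rsumN; last 2 first.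
- exact: summable_scale.
- have := @summable_scale (- a) _ sn; congr (summable _ _).
  by apply/funext => t /=; rewrite mulNr.
rewrite !Z// -mulrBr; congr (_ * _).
by rewrite rsum_ge0E// [X in _ - X]rsum_ge0E.
Qed.

Lemma rsum_eq0 f : (forall t, 0 <= f t) -> sm f -> rsum f = 0 ->
  forall t, f t = 0.
Proof.
move=> f0 sf + t; rewrite rsum_ge0E// => e0.
have : ((f t)%:E <= \esum_(t in [set: T]) (f t)%:E)%E.
  apply: esum_ge; exists [set t]; last by rewrite fsbig_set1.
  by split=> //; exact: finite_set1.
rewrite -(fineK (esum_fin f0 sf)) e0 lee_fin => ft0.
by apply/eqP; rewrite eq_le ft0 f0.
Qed.

Lemma rsum_reindex (e : T -> T) f : bijective e ->
  rsum (fun t => f (e t)) = rsum f.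
Proof.
move=> be; rewrite /rsum.
have st : set_bij [set: T] [set: T] e.
  split=> //; first by move=> x y _ _; exact: (bij_inj be).
  by case: be => g eg ge x _; exists (g x).
by congr (fine _ - fine _); apply/esym; exact: (@reindex_esum _ _ _ _ _ _ _ st).
Qed.

Lemma rsum_support (A : {fset T}) f : (forall t, t \notin A -> f t = 0) ->
  rsum f = \sum_(t <- A) f t.
Proof.
have h g : (forall t, 0 <= g t) -> (forall t, t \notin A -> g t = 0) ->
    (\esum_(t in [set: T]) (g t)%:E)%E = (\sum_(t <- A) g t)%:E.
  move=> g0 gA; rewrite (@eq_esum _ _ _ _
    (fun t => if t \in [set` A] then (g t)%:E else 0%E)); last first.
    move=> t _; case: ifPn => //; rewrite notin_setE => /negP tA.
    by rewrite gA.
  rewrite -esum_mkcond esum_fset//; last by move=> t _; rewrite lee_fin.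
  by rewrite fsbig_finite//= set_fsetK sumEFin.
move=> fA; rewrite /rsum !h.
- rewrite /= -sumrB; apply: eq_bigr => t _; by rewrite -[LHS]posBneg.
- by move=> t; exact: neg_ge0.
- by move=> t /fA ->; rewrite oppr0 maxxx.
- by move=> t; exact: pos_ge0.
- by move=> t /fA ->; rewrite maxxx.
Qed.

End Rsum.

(** * The real scalar product on ell^2 *)

Section RealForm.
Context {R : realType} {T : choiceType}.
Implicit Types F G H : T -> R[i].

Local Notation Re := complex.Re.
Local Notation Im := complex.Im.
Definition rip F G : R := rsum (fun t => Re (F t) * Re (G t) + Im (F t) * Im (G t)).

Lemma Re_inner F G : Re (inner F G) = rip F G.
Proof.
rewrite /inner /csum /= /rip; congr rsum; apply/funext => t.
by case: (F t) (G t) => [a b] [c d] /=; rewrite mulNr opprK.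
Qed.

Lemma ReD (x y : R[i]) : Re (x + y) = Re x + Re y. Proof. by case: x y => ? ? []. Qed.
Lemma ImD (x y : R[i]) : Im (x + y) = Im x + Im y. Proof. by case: x y => ? ? []. Qed.
Lemma ReM (x y : R[i]) : Re (x * y) = Re x * Re y - Im x * Im y.
Proof. by case: x y => ? ? []. Qed.
Lemma ImM (x y : R[i]) : Im (x * y) = Re x * Im y + Im x * Re y.
Proof. by case: x y => ? ? []. Qed.

Lemma Re_sqr_norm (x : R[i]) : Re (`|x| ^+ 2) = Re x ^+ 2 + Im x ^+ 2.
Proof. by rewrite -add_Re2_Im2. Qed.

Let sm (f : T -> R) := summable [set: T] (EFin \o f).
Let nsq F t := Re (F t) * Re (F t) + Im (F t) * Im (F t).

Let nsq_ge0 F t : 0 <= nsq F t.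
Proof. by rewrite addr_ge0// -expr2 sqr_ge0. Qed.

Lemma sqnormE F : sqnorm F = (\esum_(t in [set: T]) (nsq F t)%:E)%E.
Proof. by apply: eq_esum => t _; rewrite Re_sqr_norm !expr2. Qed.

Lemma sqnorm_ge0 F : (0 <= sqnorm F)%E.
Proof. by rewrite sqnormE; apply: esum_ge0 => t _; rewrite lee_fin. Qed.

Lemma ell2P F : ell2 F <-> sm (nsq F).
Proof.
rewrite /ell2 /= sqnormE /sm /summable.
rewrite [X in _ <-> is_true (X < _)%E](@eq_esum _ _ _ _ (fun t => (nsq F t)%:E))//.
by move=> t _ /=; rewrite ger0_norm.
Qed.

Lemma rip_fine F : rip F F = fine (sqnorm F).
Proof. by rewrite sqnormE; apply: rsum_ge0E => t; exact: nsq_ge0. Qed.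

Lemma sqnorm_rip F : ell2 F -> sqnorm F = (rip F F)%:E.
Proof.
by move=> hF; rewrite rip_fine fineK// ge0_fin_numE ?sqnorm_ge0.
Qed.

Lemma ell2_lin (a : R[i]) F G : ell2 F -> ell2 G -> ell2 (fun t => a * F t + G t).
Proof.
move=> /ell2P hF /ell2P hG; apply/ell2P.
have := summable_add (summable_scale (2 * (Re a ^+ 2 + Im a ^+ 2)) hF)
  (summable_scale 2 hG).
apply: summable_le => t; rewrite ger0_norm// /nsq !(ReD, ImD, ReM, ImM).
set ar := Re a; set ai := Im a; set fr := Re (F t); set fi := Im (F t).
set gr := Re (G t); set gi := Im (G t).
(* Parallelogram law: 2 |a F|^2 + 2 |G|^2 - |a F + G|^2 = |a F - G|^2, which is the sum of these two
   squares. *)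
have h1 := sqr_ge0 (ar * fr - ai * fi - gr); have h2 := sqr_ge0 (ar * fi + ai * fr - gi).
 rewrite -subr_ge0; have := addr_ge0 h1 h2.
by congr (_ <= _); ring.
Qed.

Lemma ell2_zero : ell2 (fun _ : T => 0 : R[i]).
Proof.
apply/ell2P; rewrite /sm /summable esum1 ?ltry// => t _ /=.
by rewrite /nsq /= mulr0 addr0 normr0.
Qed.

Lemma ell2_add F G : ell2 F -> ell2 G -> ell2 (fun t => F t + G t).
Proof.
move=> hF hG; have := ell2_lin 1 hF hG; congr (ell2 _).
by apply/funext => t; rewrite mul1r.
Qed.

Lemma ell2_scale (a : R[i]) F : ell2 F -> ell2 (fun t => a * F t).
Proof.
move=> hF; have := ell2_lin a hF ell2_zero; congr (ell2 _).
by apply/funext => t; rewrite addr0.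
Qed.

Lemma ell2_sub F G : ell2 F -> ell2 G -> ell2 (fun t => F t - G t).
Proof.
move=> hF hG; have := ell2_lin (-1) hG hF; congr (ell2 _).
by apply/funext => t; rewrite mulN1r addrC.
Qed.

Lemma ell2_comp (e : T -> T) F : bijective e -> ell2 F -> ell2 (fun t => F (e t)).
Proof.
move=> be; rewrite /ell2 /= !sqnormE => h.
suff -> : (\esum_(t in [set: T]) (nsq (fun t0 => F (e t0)) t)%:E =
          \esum_(t in [set: T]) (nsq F t)%:E)%E by [].
have st : set_bij [set: T] [set: T] e.
  split=> //; first by move=> x y _ _; exact: (bij_inj be).
  by case: be => g eg ge x _; exists (g x).
by apply/esym; exact: (@reindex_esum _ _ _ _ _ _ (fun t => (nsq F t)%:E) st).
Qed.

Lemma ell2_sum (I : Type) (r : seq I) (x : I -> R[i]) (F : I -> T -> R[i]) :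
  (forall i, ell2 (F i)) -> ell2 (fun t => \sum_(i <- r) x i * F i t).
Proof.
move=> hF; elim: r => [|i r IH].
  by have := ell2_zero; congr (ell2 _); apply/funext => t; rewrite big_nil.
have := ell2_lin (x i) (hF i) IH; congr (ell2 _).
by apply/funext => t; rewrite big_cons.
Qed.

Let sm_prod F G : ell2 F -> ell2 G ->
  sm (fun t => Re (F t) * Re (G t) + Im (F t) * Im (G t)).
Proof.
move=> /ell2P hF /ell2P hG; have := summable_add hF hG.
apply: summable_le => t; rewrite /nsq.
set fr := Re (F t); set fi := Im (F t).
set gr := Re (G t); set gi := Im (G t).
rewrite ler_norml; apply/andP; split; rewrite -subr_ge0.
  have -> : fr * gr + fi * gi - - (fr * fr + fi * fi + (gr * gr + gi * gi)) =
    (fr ^+ 2 + fi ^+ 2 + gr ^+ 2 + gi ^+ 2 + (fr + gr) ^+ 2 + (fi + gi) ^+ 2) / 2.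
    by field.
  by rewrite divr_ge0// !addr_ge0// sqr_ge0.
have -> : fr * fr + fi * fi + (gr * gr + gi * gi) - (fr * gr + fi * gi) =
  (fr ^+ 2 + fi ^+ 2 + gr ^+ 2 + gi ^+ 2 + (fr - gr) ^+ 2 + (fi - gi) ^+ 2) / 2.
  by field.
by rewrite divr_ge0// !addr_ge0// sqr_ge0.
Qed.

Lemma ripC F G : rip F G = rip G F.
Proof. by congr rsum; apply/funext => t; rewrite mulrC [X in _ + X]mulrC. Qed.

Lemma ripDr F G H : ell2 F -> ell2 G -> ell2 H ->
  rip F (fun t => G t + H t) = rip F G + rip F H.
Proof.
move=> hF hG hH; rewrite /rip -rsumD; [|exact: sm_prod..].
by congr rsum; apply/funext => t; rewrite ReD ImD; ring.
Qed.

Lemma ripZr (a : R) F G : ell2 F -> ell2 G ->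
  rip F (fun t => a%:C%C * G t) = a * rip F G.
Proof.
move=> hF hG; rewrite /rip -rsumZ; last exact: sm_prod.
by congr rsum; apply/funext => t; rewrite ReM ImM /=; ring.
Qed.

Lemma ripDl F G H : ell2 F -> ell2 G -> ell2 H ->
  rip (fun t => G t + H t) F = rip G F + rip H F.
Proof. by move=> *; rewrite ripC ripDr// ![rip F _]ripC. Qed.

Lemma ripZl (a : R) F G : ell2 F -> ell2 G ->
  rip (fun t => a%:C%C * G t) F = a * rip G F.
Proof. by move=> *; rewrite ripC ripZr// [rip F _]ripC. Qed.

Lemma ripBr F G H : ell2 F -> ell2 G -> ell2 H ->
  rip F (fun t => G t - H t) = rip F G - rip F H.
Proof.
move=> hF hG hH.
have -> : (fun t => G t - H t) = (fun t => G t + (-1)%:C%C * H t).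
  by apply/funext => t; rewrite rmorphN1 mulN1r.
by rewrite ripDr// ?ripZr ?mulN1r//; exact: ell2_scale.
Qed.

Lemma ripBl F G H : ell2 F -> ell2 G -> ell2 H ->
  rip (fun t => G t - H t) F = rip G F - rip H F.
Proof. by move=> *; rewrite ripC ripBr// ![rip F _]ripC. Qed.

Lemma rip0r F : rip F (fun=> 0) = 0.
Proof.
rewrite /rip -[RHS](@rsum0 R T); congr rsum.
by apply/funext => t /=; rewrite !mulr0 addr0.
Qed.

Lemma rip0l F : rip (fun=> 0) F = 0. Proof. by rewrite ripC rip0r. Qed.

Lemma rip_ge0 F : 0 <= rip F F.
Proof. by apply: rsum_ge0 => t; exact: nsq_ge0. Qed.

Lemma rip_eq0 F : ell2 F -> rip F F = 0 -> F = fun=> 0.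
Proof.
move=> hF /(rsum_eq0 (nsq_ge0 F)) h0; apply/funext => t.
have /eqP := h0 (sm_prod hF hF) t; rewrite /nsq -!expr2 paddr_eq0 ?sqr_ge0//.
rewrite !sqrf_eq0 => /andP[/eqP a /eqP b].
by move: a b; case: (F t) => ? ? /= -> ->.
Qed.

Lemma rip_comp (e : T -> T) F G : bijective e ->
  rip (fun t => F (e t)) (fun t => G (e t)) = rip F G.
Proof.
exact: (@rsum_reindex R T e (fun t => Re (F t) * Re (G t) + Im (F t) * Im (G t))).
Qed.

Lemma rip_compl (e e' : T -> T) F G : cancel e e' -> cancel e' e ->
  rip (fun t => F (e t)) G = rip F (fun t => G (e' t)).
Proof.
move=> ee' e'e; have be : bijective e' by exists e.
rewrite -[LHS](rip_comp _ _ be); congr (rip _ (fun t => G (e' t))).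
by apply/funext => t; rewrite e'e.
Qed.

(* Cauchy-Schwarz for any positive symmetric form, from its values on a line. *)
Lemma discriminant_le (p q w : R) : 0 <= p -> 0 <= q ->
  (forall t : R, 0 <= p + 2 * t * w + t ^+ 2 * q) -> w ^+ 2 <= p * q.
Proof.
move=> p0; rewrite le_eqVlt => /predU1P[<-|q0] h.
  suff -> : w = 0 by rewrite expr0n mulr0.
  apply/eqP/negPn/negP => w0.
  have := h (- (p + 1) / w / 2).
  rewrite mulr0 addr0 (_ : _ + _ = -1); first by rewrite ler0N1.
  by field.
have := h (- w / q); rewrite (_ : _ + _ = (p * q - w ^+ 2) / q).
  by rewrite pmulr_lge0 ?invr_gt0// subr_ge0.
by field; rewrite gt_eqF.
Qed.

Lemma CauchySchwarz_rip F G : ell2 F -> ell2 G ->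
  rip F G ^+ 2 <= rip F F * rip G G.
Proof.
move=> hF hG; apply: discriminant_le; rewrite ?rip_ge0// => t.
have htG : ell2 (fun s => t%:C%C * G s) by exact: ell2_scale.
have := rip_ge0 (fun s => F s + t%:C%C * G s).
rewrite ripDl ?ripDr// ?ripZr ?ripZl//; last exact: ell2_add.
by rewrite [rip G F]ripC; congr (_ <= _); ring.
Qed.

Definition delta (v : T) : T -> R[i] := \1_[set v].

Lemma deltaE v t : delta v t = (t == v)%:R.
Proof. by rewrite /delta indicE in_set1. Qed.

Lemma rip_delta v F : rip (delta v) F = Re (F v).
Proof.
rewrite /rip (@rsum_support _ _ [fset v]%fset) ?big_seq_fset1.
  by rewrite deltaE eqxx /= mul1r mul0r addr0.
by move=> t; rewrite inE => /negbTE h; rewrite deltaE h /= !mul0r addr0.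
Qed.

Lemma ell2_delta v : ell2 (delta v).
Proof.
apply/ell2P; rewrite /sm summableE.
rewrite (@eq_esum _ _ _ _ (fun t => if t \in [set v] then 1%E else 0%E)).
  by rewrite -esum_mkcond esum_set1// lee_fin.
move=> t _; rewrite /= /nsq deltaE in_set1.
by case: eqP => _ /=; rewrite ?mulr0 ?mulr1 ?addr0 ?normr0 ?normr1.
Qed.

End RealForm.

(** * Traces and ranks *)

Section TraceRank.
Context {R : realType}.
Local Notation Re := complex.Re.
Local Notation Im := complex.Im.
Local Open Scope sesquilinear_scope.
Import spectral.

Lemma Re_sum (I : Type) (r : seq I) (P : pred I) (F : I -> R[i]) :
  Re (\sum_(i <- r | P i) F i) = \sum_(i <- r | P i) Re (F i).
Proof. by elim/big_rec2: _ => //= i x y _ <-; rewrite ReD. Qed.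

(** The rows of [S] are orthonormal and span the rows of [M], so M = M S^H S and tr M = tr (S M
    S^H), a sum of [r] values of the form at unit vectors. *)
Let Re_mxtrace_le_sub n r (M : 'M[R[i]]_n) (S : 'M[R[i]]_(r, n)) :
  (forall u : 'rV_n, Re ((u *m M *m u^t*) 0 0) <= Re ((u *m u^t*) 0 0)) ->
  S *m S^t* = 1%:M -> (M <= S)%MS -> Re (\tr M) <= r%:R.
Proof.
move=> M1 S1 /submxP[D MD].
have MS : M *m S^t* *m S = M by rewrite {1}MD -(mulmxA D) S1 mulmx1 -MD.
have -> : \tr M = \tr (S *m M *m S^t*).
  by rewrite -[X in _ = \tr X]mulmxA [RHS]mxtrace_mulC MS.
rewrite /mxtrace Re_sum -[X in _ <= X%:R]card_ord -sum1_card natr_sum.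
apply: ler_sum => i _.
suff e : Re ((row i S *m (row i S)^t*) 0 0) = 1.
  rewrite -[leRHS]e; apply: le_trans (M1 (row i S)); rewrite -!row_mul.
  rewrite le_eqVlt; apply/orP; left; apply/eqP; congr Re.
  by rewrite !mxE; apply: eq_bigr => k _; rewrite !mxE.
have := congr1 (fun A : 'M[R[i]]_r => Re (A i i)) S1.
rewrite !mxE eqxx /= => <-; congr Re.
by apply: eq_bigr => k _; rewrite !mxE.
Qed.

Let Re_mxtrace_le n (M : 'M[R[i]]_n) :
  (forall u : 'rV_n, Re ((u *m M *m u^t*) 0 0) <= Re ((u *m u^t*) 0 0)) ->
  Re (\tr M) <= (\rank M)%:R.
Proof.
move=> M1; apply: (@Re_mxtrace_le_sub _ _ M (spectral.schmidt (row_base M))) => //.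
  exact/unitarymxP/schmidt_unitarymx/rank_leq_col.
by rewrite -(eq_row_base M) schmidt_sub.
Qed.

(** The trace is at most the rank when the form is at most the identity, and the rank is at most the
    number of linear conditions that force a vector into the kernel. Both trace estimates for
    eigenspaces are instances: one for a compressed projection, one for its complement. *)
Lemma Re_trace_le_card (I J : finType) (m : I -> I -> R[i]) (f : I -> J -> R[i]) :
  (forall x : I -> R[i],
    Re (\sum_i \sum_j x i * m i j * (x j)^*%C) <= \sum_i Re (x i * (x i)^*%C)) ->
  (forall x : I -> R[i], (forall j, \sum_i x i * f i j = 0) ->
    forall k, \sum_i x i * m i k = 0) ->
  \sum_i Re (m i i) <= #|J|%:R.
Proof.
move=> m1 mf.
pose M : 'M[R[i]]_#|I| := \matrix_(i, j) m (enum_val i) (enum_val j).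
pose L : 'M[R[i]]_(#|I|, #|J|) := \matrix_(i, j) f (enum_val i) (enum_val j).
have conjE (z : R[i]) : Num.conj z = z^*%C by [].
have -> : \sum_i Re (m i i) = Re (\tr M).
  rewrite /mxtrace Re_sum (reindex (@enum_val I I)) /=.
    by apply: eq_bigr => i _; rewrite mxE.
  exact/onW_bij/enum_val_bij.
have rkM : (\rank M <= \rank L)%N.
  have : (kermx L <= kermx M)%MS.
    apply/row_subP => i; apply/sub_kermxP.
    have /sub_kermxP uL : (row i (kermx L) <= kermx L)%MS by rewrite row_sub.
    move: (row i _) uL => u uL; apply/rowP => k; rewrite !mxE.
    pose x i := u 0 (enum_rank i).
    have xL j : \sum_i x i * f i j = 0.
      rewrite (reindex (@enum_val I I)) /=; last exact/onW_bij/enum_val_bij.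
      transitivity ((u *m L) 0 (enum_rank j)); last by rewrite uL mxE.
      rewrite mxE.
      by apply: eq_bigr => j0 _; rewrite /x enum_valK mxE enum_rankK.
    rewrite -[RHS](mf x xL (enum_val k)).
    rewrite [RHS](reindex (@enum_val I I)) /=; last exact/onW_bij/enum_val_bij.
    by apply: eq_bigr => j _; rewrite /x enum_valK mxE.
  move/mxrankS; rewrite !mxrank_ker.
  have := rank_leq_row M; have := rank_leq_row L; lia.
apply: (@le_trans _ _ (\rank M)%:R); last first.
  by rewrite ler_nat (leq_trans rkM)// rank_leq_col.
apply: Re_mxtrace_le => u.
pose x i := u 0 (enum_rank i).
have := m1 x; congr (_ <= _).
  congr Re; rewrite !mxE (reindex (@enum_val I I)) /=; last exact/onW_bij/enum_val_bij.
  under eq_bigr => i _.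
    rewrite (reindex (@enum_val I I)) /=; last exact/onW_bij/enum_val_bij.
    under eq_bigr do rewrite /x !enum_valK.
    over.
  rewrite exchange_big; apply: eq_bigr => j _ /=.
  rewrite !mxE mulr_suml; apply: eq_bigr => i _.
  by rewrite !mxE conjE.
rewrite -Re_sum; congr Re.
rewrite !mxE (reindex (@enum_val I I)) /=; last exact/onW_bij/enum_val_bij.
by apply: eq_bigr => j _; rewrite /x !enum_valK !mxE conjE.
Qed.

End TraceRank.

(** * Spectral calculus *)

Section BoundedPVM.
Context {R : realType} {T : choiceType}.
Context {P : set R -> (T -> R[i]) -> T -> R[i]} (pvmP : is_bounded_pvm P).
Implicit Types (F G : T -> R[i]) (B C : set R).

Lemma pvm_ell2 B F : measurable B -> ell2 F -> ell2 (P B F).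
Proof. by move=> mB; exact: (orth_proj_ell2 (pvm_orth_proj pvmP mB)). Qed.
Hint Resolve pvm_ell2 : core.

Lemma pvm_lin B (a : R[i]) F G : measurable B -> ell2 F -> ell2 G ->
  P B (fun t => a * F t + G t) = fun t => a * P B F t + P B G t.
Proof. by move=> mB; exact: (orth_proj_linear (pvm_orth_proj pvmP mB)). Qed.

Lemma pvmD B F G : measurable B -> ell2 F -> ell2 G ->
  P B (fun t => F t + G t) = fun t => P B F t + P B G t.
Proof.
move=> mB hF hG; have := pvm_lin 1 mB hF hG.
rewrite (_ : (fun t => 1 * F t + G t) = (fun t => F t + G t)); last first.
  by apply/funext => t; rewrite mul1r.
by move=> ->; apply/funext => t; rewrite mul1r.
Qed.

Lemma pvmB B F G : measurable B -> ell2 F -> ell2 G ->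
  P B (fun t => F t - G t) = fun t => P B F t - P B G t.
Proof.
move=> mB hF hG; have := pvm_lin (-1) mB hG hF.
rewrite (_ : (fun t => -1 * G t + F t) = (fun t => F t - G t)); last first.
  by apply/funext => t; rewrite mulN1r addrC.
by move=> ->; apply/funext => t; rewrite mulN1r addrC.
Qed.

Lemma pvm_0 B : measurable B -> P B (fun=> 0) = fun=> 0.
Proof.
move=> mB; have := pvmB mB (@ell2_zero R T) (@ell2_zero R T).
rewrite (_ : (fun t : T => 0 - 0) = fun=> 0 :> R[i]); last by apply/funext => t; rewrite subrr.
by move=> ->; apply/funext => t; rewrite subrr.
Qed.

Lemma pvm_adj B F G : measurable B -> ell2 F -> ell2 G ->
  rip F (P B G) = rip (P B F) G.
Proof.
move=> mB hF hG; rewrite -!Re_inner.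
by rewrite (orth_proj_adj (pvm_orth_proj pvmP mB)).
Qed.

Lemma pvm_idem B F : measurable B -> ell2 F -> P B (P B F) = P B F.
Proof. by move=> mB; exact: (orth_proj_idem (pvm_orth_proj pvmP mB)). Qed.

Lemma rip_pvm B F : measurable B -> ell2 F -> rip F (P B F) = rip (P B F) (P B F).
Proof. by move=> mB hF; rewrite -[in LHS]pvm_idem// pvm_adj//; exact: pvm_ell2. Qed.

Lemma rip_pvm_ge0 B F : measurable B -> ell2 F -> 0 <= rip F (P B F).
Proof. by move=> mB hF; rewrite rip_pvm// rip_ge0. Qed.

Lemma pvm_disjoint B C F : measurable B -> measurable C -> ell2 F ->
  B `&` C = set0 -> P B (P C F) = fun=> 0.
Proof. by move=> mB mC hF BC; rewrite -(pvm_setI pvmP)// BC (pvm_set0 pvmP). Qed.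

Lemma pvm_subr B C F : measurable B -> measurable C -> ell2 F ->
  B `<=` C -> P B (P C F) = P B F.
Proof. by move=> mB mC hF BC; rewrite -(pvm_setI pvmP)// (setIidl BC). Qed.

(* Finite additivity follows from countable additivity because a constant
   sequence of squared norms tending to 0 vanishes. *)
Lemma pvm_setU B C F : measurable B -> measurable C -> ell2 F ->
  B `&` C = set0 -> P (B `|` C) F = fun t => P B F t + P C F t.
Proof.
move=> mB mC hF BC.
have mBC n : measurable (bigcup2 B C n) by case: n => [|[|n]] /=.
have tBC : trivIset setT (bigcup2 B C).
  by rewrite -trivIset_bigcup2.
set D := fun t => P (B `|` C) F t - (P B F t + P C F t).
have hD : ell2 D.
  by apply: ell2_sub; [|apply: ell2_add]; apply: pvm_ell2 => //; exact: measurableU.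
have h : sqnorm D @[_ --> \oo] --> 0%E.
  pose u n := sqnorm (fun t => P (B `|` C) F t - \sum_(k < n) P (bigcup2 B C k) F t).
  have uE n : u (n + 2)%N = sqnorm D.
    congr sqnorm; apply/funext => t; congr (_ - _).
    rewrite addn2 big_ord_recl big_ord_recl /= big1 ?addr0// => k _.
    by rewrite (pvm_set0 pvmP).
  have : u n @[n --> \oo] --> 0%E.
    by have := pvm_sigma_additive pvmP mBC tBC hF; rewrite bigcup2E.
  rewrite -(cvg_shiftn 2) (_ : (fun n => u (n + 2)%N) = fun=> sqnorm D)//.
  by apply/funext => n; rewrite uE.
have {h} : lim (sqnorm D @[_ --> \oo]) = 0%E.
  exact: (cvg_lim (@ereal_hausdorff R) h).
rewrite lim_cst; last exact: ereal_hausdorff.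
rewrite sqnorm_rip// => -[/(rip_eq0 hD) D0]; apply/funext => t.
by apply/eqP; rewrite -subr_eq0; apply/eqP; exact: (congr1 (@^~ t) D0).
Qed.

Lemma rip_pvm_setU B C F : measurable B -> measurable C -> ell2 F ->
  B `&` C = set0 -> rip F (P (B `|` C) F) = rip F (P B F) + rip F (P C F).
Proof.
move=> mB mC hF BC; rewrite pvm_setU// ripDr//; exact: pvm_ell2.
Qed.

Lemma pvm_setC B F : measurable B -> ell2 F ->
  F = fun t => P B F t + P (~` B) F t.
Proof.
move=> mB hF; rewrite -pvm_setU ?setUv ?setICr ?(pvm_setT pvmP)//.
exact: measurableC.
Qed.

Lemma rip_pvm_le B F : measurable B -> ell2 F -> rip F (P B F) <= rip F F.
Proof.
move=> mB hF; rewrite {4}(pvm_setC mB hF) ripDr//; last 2 first.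
- exact: pvm_ell2.
- by apply: pvm_ell2 => //; exact: measurableC.
by rewrite lerDl rip_pvm_ge0//; exact: measurableC.
Qed.

Lemma pvm_id_rip B F : measurable B -> ell2 F -> rip F (P B F) = rip F F ->
  P B F = F.
Proof.
move=> mB hF e; have mB' := measurableC mB.
have : rip F (P (~` B) F) = 0.
  by apply: (addrI (rip F (P B F))); rewrite -ripDr -?pvm_setC ?addr0//; exact: pvm_ell2.
rewrite rip_pvm// => /(rip_eq0 (pvm_ell2 mB' hF)) h.
by rewrite [RHS](pvm_setC mB hF) h; apply/funext => t; rewrite addr0.
Qed.

Lemma pvm_mono B C F : measurable B -> measurable C -> ell2 F -> B `<=` C ->
  rip F (P B F) <= rip F (P C F).
Proof.
move=> mB mC hF BC; rewrite [leRHS]rip_pvm// -(pvm_subr mB mC)//.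
rewrite (pvm_adj mB)//; last exact: pvm_ell2.
rewrite -(pvm_subr mB mC)// -(pvm_adj mB); [|exact: pvm_ell2..].
by apply: rip_pvm_le => //; exact: pvm_ell2.
Qed.

(** Extension by 0 off the Borel sets makes the set function nonnegative everywhere, as a measure
    structure demands. Countable additivity is the norm convergence of [pvm_sigma_additive] tested
    against [F] by Cauchy-Schwarz. *)
Lemma spectral_distribution F : ell2 F ->
  exists m : {measure set R -> \bar R},
    forall B, measurable B -> m B = (rip F (P B F))%:E.
Proof.
move=> hF.
pose mu B := (if asbool (measurable B) then (rip F (P B F))%:E else 0)%E.
have muE B : measurable B -> mu B = (rip F (P B F))%:E.
  by move=> mB; rewrite /mu; case: asboolP.
have mu0 : mu set0 = 0%E by rewrite muE// (pvm_set0 pvmP)// rip0r.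
have mu_ge0 B : (0 <= mu B)%E.
  by rewrite /mu; case: asboolP => // mB; rewrite lee_fin rip_pvm_ge0.
have mu_sig : semi_sigma_additive mu.
  move=> B mB tB mUB; rewrite muE//.
  have sumE n : (\sum_(0 <= i < n) mu (B i))%E =
      (rip F (fun t => \sum_(k < n) P (B k) F t))%:E.
    rewrite big_mkord; under eq_bigr do rewrite muE//.
    rewrite sumEFin; congr EFin.
    elim: n => [|n IH].
      rewrite big_ord0 -[LHS](rip0r F); congr rip.
      by apply/funext => t; rewrite big_ord0.
    rewrite big_ord_recr /= IH -ripDr//; last exact: pvm_ell2.
      by congr rip; apply/funext => t; rewrite big_ord_recr.
    have := @ell2_sum R T _ (index_enum 'I_n) (fun=> 1) (fun k => P (B k) F)
      (fun k => pvm_ell2 (mB k) hF).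
    by congr (ell2 _); apply/funext => t; apply: eq_bigr => k _; rewrite mul1r.
  under eq_fun do rewrite sumE.
  apply: cvg_EFin; first exact: nearW.
  have sig := pvm_sigma_additive pvmP mB tB hF.
  pose S n t := \sum_(k < n) P (B k) F t.
  pose D n t := P (\bigcup_n B n) F t - S n t.
  have hS n : ell2 (S n).
    have := @ell2_sum R T _ (index_enum 'I_n) (fun=> 1) (fun k => P (B k) F)
      (fun k => pvm_ell2 (mB k) hF).
    by congr (ell2 _); apply/funext => t; apply: eq_bigr => k _; rewrite mul1r.
  have hD n : ell2 (D n) by apply: ell2_sub => //; exact: pvm_ell2.
  have D0 : rip (D n) (D n) @[n --> \oo] --> (0 : R).
    have -> : (fun n => rip (D n) (D n)) = fine \o (fun n => sqnorm (D n)).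
      by apply/funext => n; rewrite /= rip_fine.
    exact: fine_cvg sig.
  apply/cvgrPdist_lt => e e0.
  have FF0 : 0 < rip F F + 1 by rewrite ltr_wpDl// rip_ge0.
  have d0 : 0 < e ^+ 2 / (rip F F + 1) by rewrite divr_gt0// exprn_gt0.
  move/cvgrPdist_lt : D0 => /(_ _ d0); apply: filterS => n.
  rewrite sub0r normrN ger0_norm ?rip_ge0// ltr_pdivlMr// => h.
  have {h} h : rip F (D n) ^+ 2 < e ^+ 2.
    apply: le_lt_trans (CauchySchwarz_rip hF (hD n)) _; apply: le_lt_trans h.
    by rewrite mulrC ler_wpM2l ?rip_ge0// lerDl.
  have <- : rip F (D n) = rip F (P (\bigcup_n B n) F) - rip F (S n).
    by apply: ripBr => //; exact: pvm_ell2.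
  by rewrite -(@ltr_pXn2r _ 2)// ?nnegrE ?(ltW e0)// real_normK// num_real.
pose b := isMeasure.Build _ R R mu mu0 mu_ge0 mu_sig.
pose m : {measure set R -> \bar R} := HB.pack mu b.
by exists m => B mB; rewrite -muE.
Qed.

End BoundedPVM.

Import HBNNSimple.

(** The spectral hypothesis integrates against a bare set function. Integrals of simple functions
    evaluate it only at measurable preimages, so a genuine measure agreeing there may replace it. *)
Lemma eq_set_integral (R : realType) (mu : set R -> \bar R)
    (m : {measure set R -> \bar R}) (D : set R) (f : R -> \bar R) :
  (forall B, measurable B -> mu B = m B) -> integral mu D f = integral m D f.
Proof.
move=> mum; rewrite /integral.
have e (h : {nnsfun R >-> R}) : sintegral mu h = sintegral m h.
  apply: eq_fsbigr => x _; congr (_ * _)%E; apply: mum.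
  by rewrite -[X in measurable X]setTI; exact: measurable_funP.
by congr (ereal_sup _ - ereal_sup _)%E; apply/seteqP; split => _ [h hf <-];
  exists h.
Qed.

(** * Positive operators: form bounds and commutation with the projections *)

Section PosOperator.
Context {R : realType} {T : choiceType}.
Implicit Types F G : T -> R[i].

Record is_pos_op (A : (T -> R[i]) -> T -> R[i]) : Prop := IsPosOp {
  op_ell2 : forall F, ell2 F -> ell2 (A F);
  op_lin : forall (a : R[i]) F G,
    A (fun t => a * F t + G t) = fun t => a * A F t + A G t;
  op_sym : forall F G, ell2 F -> ell2 G -> rip F (A G) = rip (A F) G;
  op_ge0 : forall F, ell2 F -> 0 <= rip F (A F) }.

Context {A : (T -> R[i]) -> T -> R[i]} (opA : is_pos_op A).
Context {P : set R -> (T -> R[i]) -> T -> R[i]} (spec : is_spectral_measure A P).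
Let pvmP : is_bounded_pvm P := spec.1.

Lemma opD F G : A (fun t => F t + G t) = fun t => A F t + A G t.
Proof.
have := op_lin opA 1 F G.
rewrite (_ : (fun t => 1 * F t + G t) = (fun t => F t + G t)); last first.
  by apply/funext => t; rewrite mul1r.
by move=> ->; apply/funext => t; rewrite mul1r.
Qed.

Lemma op0 : A (fun=> 0) = fun=> 0.
Proof.
have := op_lin opA (-1) (fun=> 0) (fun=> 0).
rewrite (_ : (fun t : T => -1 * 0 + 0) = fun=> 0 :> R[i]); last first.
  by apply/funext => t; rewrite mulr0 addr0.
by move=> ->; apply/funext => t; rewrite mulN1r addNr.
Qed.

Lemma opZ (a : R[i]) F : A (fun t => a * F t) = fun t => a * A F t.
Proof.
have := op_lin opA a F (fun=> 0); rewrite op0.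
rewrite (_ : (fun t => a * F t + 0) = (fun t => a * F t)); last first.
  by apply/funext => t; rewrite addr0.
by move=> ->; apply/funext => t; rewrite addr0.
Qed.

(** The bounded support replaces the integral over the line, known only through [fine], by one over
    a compact interval, where the identity is integrable and the value is finite. The bound [a] is
    independent of [F], so that the measures of several functions can be compared on one
    interval. *)
Lemma spectral_integral : exists a : R, forall F, ell2 F ->
  exists m : {measure set R -> \bar R},
    (forall B, measurable B -> m B = (rip F (P B F))%:E) /\
    m.-integrable `[- a, a]%classic EFin /\
    m `[- a, a]%classic = (rip F F)%:E /\
    (rip F (A F))%:E = (\int[m]_(x in `[(- a)%R, a]) x%:E)%E.
Proof.
have [a Pa] := pvm_bounded pvmP; exists a => F hF.
have [m mE] := spectral_distribution pvmP hF.
exists m; split => //.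
set K := `[- a, a]%classic.
have mK : measurable K by exact: measurable_itv.
have m0 : m (~` K) = 0%E.
  rewrite mE; last exact: measurableC.
  by rewrite -(Pa _ hF) (pvm_disjoint pvmP)// ?rip0r//; [exact: measurableC|exact: setICl].
have intK : m.-integrable K EFin.
  apply: measurable_bounded_integrable => //.
  - by have := mE _ mK => /= ->; rewrite ltry.
  - by exists `|a|; split; [exact: num_real|move=> M aM x; rewrite /K /= in_itv/= => xa;
      rewrite (le_trans _ (ltW aM))// (le_trans _ (ler_norm a))// ler_norml].
split=> //; split; first by rewrite (mE _ mK) Pa.
have := spec.2 F hF => /(congr1 (fun z : R[i] => complex.Re z)).
rewrite Re_inner /= => ->.
have mT := @EFin_measurable R setT.
have -> : integral (fun B => (complex.Re (inner F (P B F)))%:E) setT EFin =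
    (\int[m]_(x in K) x%:E)%E.
  rewrite (@eq_set_integral _ _ m); last by move=> B mB; rewrite Re_inner mE.
  rewrite -[K in RHS]setCK -[~` (~` K)]setTD.
  apply: negligible_integral => //; first exact: measurableC.
  apply/integrableP; split=> //.
  rewrite (@ge0_negligible_integral _ _ _ m setT (~` K))//; last 2 first.
  - exact: measurableC.
  - exact: measurableT_comp.
  by rewrite setTD setCK; have /integrableP[] := intK.
rewrite fineK//; exact: integrable_fin_num.
Qed.

End PosOperator.

Section SpectralCalculus.
Context {R : realType} {T : choiceType}.
Context {A : (T -> R[i]) -> T -> R[i]} (opA : is_pos_op A).
Context {P : set R -> (T -> R[i]) -> T -> R[i]} (spec : is_spectral_measure A P).
Let pvmP : is_bounded_pvm P := spec.1.
Implicit Types (F G : T -> R[i]) (B C : set R).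

Let PL2 := pvm_ell2 pvmP.

(** The distribution of [F] gives no mass to the complement of [B], so only points of [B] are
    integrated over, and there the identity is compared with the constant [b]. *)
Let integral_form_le B F (b : R) : measurable B -> ell2 F -> P B F = F ->
  (B `<=` [set x | x <= b] -> rip F (A F) <= b * rip F F) /\
  (B `<=` [set x | b <= x] -> b * rip F F <= rip F (A F)).
Proof.
move=> mB hF PBF; have [a /(_ F hF)[m [mE [intK [mK AE]]]]] := spectral_integral spec.
move: mK AE; set K := `[- a, a]%classic => mK AE.
have mmK : measurable K by exact: measurable_itv.
have mB' := measurableC mB.
have mKB : measurable (K `\` ~` B) by exact: measurableD.
have m0 : m (~` B) = 0%E.
  by rewrite mE// -PBF (pvm_disjoint pvmP)// ?rip0r// setICl.
have KBE : m (K `\` ~` B) = (rip F F)%:E.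
  by rewrite -mK mE// setDE setCK (pvm_setI pvmP)// PBF mE.
have AE' : (rip F (A F))%:E = (\int[m]_(x in K `\` ~` B) x%:E)%E.
  by rewrite AE; exact: negligible_integral.
have intKB : m.-integrable (K `\` ~` B) EFin.
  by apply: integrableS intK => //; exact: subDsetl.
have intb : m.-integrable (K `\` ~` B) (cst b%:E).
  by apply: measurable_bounded_integrable => //;
    [rewrite KBE ltry | exists `|b|; split; [exact: num_real|move=> M bM x _ /=; exact: ltW]].
have cstE : (b * rip F F)%:E = (\int[m]_(x in K `\` ~` B) (cst b%:E) x)%E.
  by rewrite integral_cst// KBE.
split=> Bb; rewrite -lee_fin AE' cstE; apply: le_integral => // x;
  by rewrite inE => -[_ /contrapT /Bb]; rewrite /= lee_fin.
Qed.

Lemma form_le B F (b : R) : measurable B -> ell2 F -> P B F = F ->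
  B `<=` [set x | x <= b] -> rip F (A F) <= b * rip F F.
Proof. by move=> mB hF /(integral_form_le b mB hF)[]. Qed.

Lemma form_ge B F (b : R) : measurable B -> ell2 F -> P B F = F ->
  B `<=` [set x | b <= x] -> b * rip F F <= rip F (A F).
Proof. by move=> mB hF /(integral_form_le b mB hF)[]. Qed.

(* The measures of F and G add up to that of F + G, so the cross terms of the
   quadratic form vanish. *)
Lemma form_disjoint B C F G : measurable B -> measurable C -> ell2 F -> ell2 G ->
  B `&` C = set0 -> rip (P B F) (A (P C G)) = 0.
Proof.
move=> mB mC hF0 hG0 BC; set F1 := P B F; set G1 := P C G.
have hF : ell2 F1 by exact: PL2.
have hG : ell2 G1 by exact: PL2.
have hS : ell2 (fun t => F1 t + G1 t) by exact: ell2_add.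
have [a H] := spectral_integral spec.
have [mF [mFE [iF [_ AF]]]] := H _ hF.
have [mG [mGE [iG [_ AG]]]] := H _ hG.
have [mS [mSE [iS [_ AS]]]] := H _ hS.
have cross B' : measurable B' -> rip F1 (P B' G1) = 0.
  move=> mB'; rewrite /F1 /G1 -(pvm_adj pvmP mB)//; last by do 2 apply: PL2 => //.
  rewrite -(pvm_setI pvmP)//.
  rewrite -(pvm_setI pvmP)//; last exact: measurableI.
  have -> : B `&` B' `&` C = set0 by rewrite setIAC BC set0I.
  by rewrite (pvm_set0 pvmP)// rip0r.
have SE : (rip (fun t => F1 t + G1 t) (A (fun t => F1 t + G1 t)))%:E =
    (rip F1 (A F1))%:E + (rip G1 (A G1))%:E.
  rewrite AS AF AG -integral_measure_add//.
  apply: eq_measure_integral => B' mB' _; rewrite /measure_add /=.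
  rewrite [RHS](_ : _ = mF B' + mG B')%E; last by rewrite /msum !big_ord_recl big_ord0 adde0.
  rewrite mSE// mFE// mGE// -EFinD; congr EFin.
  have [hF' hG'] : ell2 (P B' F1) /\ ell2 (P B' G1) by split; exact: PL2.
  rewrite (pvmD pvmP)// ripDr// ?ripDl//.
  have -> : rip G1 (P B' F1) = 0 by rewrite (pvm_adj pvmP)// ripC cross.
  by rewrite (cross B' mB') addr0 add0r.
have [hF' hG'] : ell2 (A F1) /\ ell2 (A G1) by split; exact: (op_ell2 opA).
move: SE; rewrite (opD opA) -EFinD => -[].
rewrite ripDr// ?ripDl// (op_sym opA hG hF) [rip (A G1) F1]ripC => h.
lra.
Qed.

(** By [form_disjoint] the component of A (P D G) in the range of a disjoint [P C] is orthogonal to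
    itself. Hence [A] preserves the range of [P B] and that of its complement. *)
Lemma pvm_op B F : measurable B -> ell2 F -> P B (A F) = A (P B F).
Proof.
move=> mB hF; have mB' := measurableC mB; have hA := op_ell2 opA.
have h C D G : measurable C -> measurable D -> ell2 G -> C `&` D = set0 ->
    P C (A (P D G)) = fun=> 0.
  move=> mC mD hG CD; have hAG : ell2 (A (P D G)) by exact/hA/PL2.
  apply: rip_eq0; first exact: PL2.
  by rewrite -(rip_pvm pvmP)// ripC form_disjoint.
have [hB hB'] : ell2 (A (P B F)) /\ ell2 (A (P (~` B) F)).
  by split; apply: hA; exact: PL2.
have -> : A F = fun t => A (P B F) t + A (P (~` B) F) t.
  by rewrite -(opD opA) -(pvm_setC pvmP).
rewrite (pvmD pvmP mB hB hB') (h B (~` B))// ?setICr//.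
rewrite [RHS](pvm_setC pvmP mB hB) (h (~` B) B)// setICl//.
Qed.

End SpectralCalculus.

(** * Norm bounds, distribution functions, invariance and eigenspaces *)

Section SpectralProjections.
Context {R : realType} {T : choiceType}.
Context {A : (T -> R[i]) -> T -> R[i]} (opA : is_pos_op A).
Context {P : set R -> (T -> R[i]) -> T -> R[i]} (spec : is_spectral_measure A P).
Let pvmP : is_bounded_pvm P := spec.1.
Implicit Types (F G : T -> R[i]) (B C : set R).

Let PL2 := pvm_ell2 pvmP.
Let AL2 := op_ell2 opA.

Let mle (a : R) : measurable `]-oo, a]%classic. Proof. exact: measurable_itv. Qed.
Let mgt (a : R) : measurable `]a, +oo[%classic. Proof. exact: measurable_itv. Qed.
Let mlt (a : R) : measurable `]-oo, a[%classic. Proof. exact: measurable_itv. Qed.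
Let m1 (a : R) : measurable [set a]. Proof. exact: measurable_set1. Qed.

Let setC_le (a : R) : ~` `]-oo, a]%classic = `]a, +oo[%classic.
Proof. by rewrite setCitvl. Qed.

Lemma form_CauchySchwarz F G : ell2 F -> ell2 G ->
  rip G (A F) ^+ 2 <= rip F (A F) * rip G (A G).
Proof.
move=> hF hG; apply: discriminant_le; rewrite ?(op_ge0 opA)// => t.
have htG : ell2 (fun s => t%:C%C * G s) by exact: ell2_scale.
have [hAF hAG] : ell2 (A F) /\ ell2 (A G) by split; exact: AL2.
have htAG : ell2 (fun s => t%:C%C * A G s) by exact: ell2_scale.
have := op_ge0 opA (ell2_add hF htG).
rewrite (opD opA) (opZ opA) ripDr ?ripDl ?ripZr ?ripZl//; last exact: ell2_add.
have -> : rip F (A G) = rip G (A F) by rewrite (op_sym opA)// ripC.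
by congr (_ <= _); ring.
Qed.

Lemma pvm_le_id b F : ell2 F -> P `]b, +oo[%classic F = (fun=> 0) ->
  P `]-oo, b]%classic F = F.
Proof.
move=> hF h; rewrite [RHS](pvm_setC pvmP (mle b) hF) setC_le h.
by apply/funext => t; rewrite addr0.
Qed.

(** Cauchy-Schwarz for the form of [A] at F and A F: |A F|^4 <= (F, A F) (A F, A A F) <= b |F|^2 b
    |A F|^2, the last factor because A F stays in the range of the projection. *)
Lemma op_norm_le b F : 0 <= b -> ell2 F -> P `]-oo, b]%classic F = F ->
  rip (A F) (A F) <= b ^+ 2 * rip F F.
Proof.
move=> b0 hF PF; have hA := AL2 hF.
have PA : P `]-oo, b]%classic (A F) = A F by rewrite (pvm_op opA spec)// PF.
have sub : `]-oo, b]%classic `<=` [set x | x <= b] by move=> x /=; rewrite in_itv.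
have h1 := form_le spec (mle b) hF PF sub.
have h2 := form_le spec (mle b) hA PA sub.
have := form_CauchySchwarz hF hA; set n := rip (A F) (A F) in h2 *.
have n0 : 0 <= n by exact: rip_ge0.
move=> cs; have {cs} : n ^+ 2 <= (b * rip F F) * (b * n).
  by apply: le_trans cs _; apply: ler_pM => //; exact: (op_ge0 opA).
have [->|nn0] := eqVneq n 0; first by rewrite mulr_ge0 ?sqr_ge0 ?rip_ge0.
rewrite expr2 mulrA ler_pM2r; last by rewrite lt0r nn0.
by congr (_ <= _); ring.
Qed.

(** Here the ordinary Cauchy-Schwarz inequality is enough: b |F|^2 <= (F, A F) <= |F| |A F|. *)
Lemma op_norm_ge b F : 0 <= b -> ell2 F -> P `]b, +oo[%classic F = F ->
  b ^+ 2 * rip F F <= rip (A F) (A F).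
Proof.
move=> b0 hF PF; have hA := AL2 hF.
have sub : `]b, +oo[%classic `<=` [set x | b <= x].
  by move=> x /=; rewrite in_itv/= andbT => /ltW.
have h1 := form_ge spec (mgt b) hF PF sub.
have := CauchySchwarz_rip hF hA.
have f0 := rip_ge0 F; have [->|nf0] := eqVneq (rip F F) 0.
  by rewrite mulr0 rip_ge0.
have : (b * rip F F) ^+ 2 <= rip F (A F) ^+ 2 by apply: lerXn2r; rewrite ?nnegrE ?mulr_ge0// (op_ge0 opA).
move=> /le_trans/[apply]; rewrite exprMn [rip F F ^+ 2]expr2 mulrA [leRHS]mulrC.
by rewrite ler_pM2r// lt0r nf0.
Qed.

Lemma pvm_neg a F : a < 0 -> ell2 F -> P `]-oo, a]%classic F = fun=> 0.
Proof.
move=> a0 hF; have hG := PL2 (mle a) hF; apply: rip_eq0 => //.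
have sub : `]-oo, a]%classic `<=` [set x | x <= a] by move=> x /=; rewrite in_itv.
have := form_le spec (mle a) hG (pvm_idem pvmP (mle a) hF) sub.
have := op_ge0 opA hG; move=> /le_trans/[apply]; rewrite nmulr_rge0// => h.
by apply/eqP; rewrite eq_le h rip_ge0.
Qed.

Lemma powers_le (a b f g : R) : 0 <= a -> a < b -> 0 <= f -> 0 <= g ->
  (forall n, b ^+ n * g <= a ^+ n * f) -> g = 0.
Proof.
move=> a0 ab f0 g0 h; apply/eqP; rewrite eq_le g0 andbT leNgt; apply/negP => gp.
have b0 : 0 < b by exact: le_lt_trans ab.
have q1 : `|a / b| < 1 by rewrite ger0_norm ?divr_ge0// ?(ltW b0)// ltr_pdivrMr// mul1r.
have f1 : 0 < f + 1 by rewrite ltr_wpDl.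
have e0 : 0 < g / (f + 1) by rewrite divr_gt0.
have /cvgrPdist_lt/(_ _ e0) := cvg_expr q1.
case => N _ /(_ N (leqnn N)) /=; rewrite sub0r normrN ger0_norm; last first.
  by rewrite exprn_ge0// divr_ge0// ltW.
rewrite ltr_pdivlMr// expr_div_n mulrAC ltr_pdivrMr ?exprn_gt0// [_ * b ^+ N]mulrC.
move=> /lt_le_trans/(_ (h N)); apply/negP; rewrite -leNgt.
by rewrite ler_wpM2l ?exprn_ge0// lerDl.
Qed.

Section Cdf.
Variables (F : T -> R[i]) (hF : ell2 F).

Definition spectral_cdf (x : R) := rip F (P `]-oo, x]%classic F).

Lemma spectral_cdf_mono x y : x <= y -> spectral_cdf x <= spectral_cdf y.
Proof.
move=> xy; apply: (pvm_mono pvmP) => // z /=; rewrite !in_itv/= => zx.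
exact: le_trans xy.
Qed.

Let spectral_cvg (m : {measure set R -> \bar R}) (B : (set R)^nat) C :
  (forall D, measurable D -> m D = (rip F (P D F))%:E) ->
  (forall n, measurable (B n)) -> measurable C ->
  (m \o B) @ \oo --> m C -> rip F (P (B n) F) @[n --> \oo] --> rip F (P C F).
Proof.
move=> mE mB mC; rewrite mE// => /fine_cvg.
suff -> : fine \o (m \o B) = fun n => rip F (P (B n) F) by [].
by apply/funext => n; rewrite /= mE.
Qed.

(** Continuity from above along a + 1 / (n + 1). For a monotone function one point within [e] is all
    of right continuity, and finitely many such points combine by a minimum. *)
Lemma spectral_cdf_right a e : 0 < e ->
  exists2 b, a < b & spectral_cdf b < spectral_cdf a + e.
Proof.
move=> e0; have [m mE] := spectral_distribution pvmP hF.
pose u n := a + n.+1%:R^-1.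
have cap : \bigcap_n `]-oo, u n]%classic = `]-oo, a]%classic.
  apply/seteqP; split => x /=; rewrite ?in_itv/=.
    move=> h; apply/ler_addgt0Pr => d d0.
    have [n hn] := ltr_add_invr d0.
    have := h n I; rewrite /= in_itv/= => /le_trans; apply.
    by rewrite lerD2l ltW// -[ltLHS]add0r.
  by move=> xa n _ /=; rewrite in_itv/= (le_trans xa)// lerDl.
have cv : (m \o (fun n => `]-oo, u n]%classic)) @ \oo --> m `]-oo, a]%classic.
  rewrite -cap; apply: nonincreasing_cvg_mu => //.
  - by rewrite mE// ltry.
  - by rewrite cap.
  - move=> i j ij; apply/subsetPset => x /=; rewrite !in_itv/= => /le_trans; apply.
    by rewrite lerD2l lef_pV2 ?posrE// ler_nat.
have /cvgrPdist_lt/(_ _ e0) := spectral_cvg mE (fun n => mle (u n)) (mle a) cv.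
case => N _ /(_ N (leqnn N)) /= h; exists (u N); first by rewrite ltrDl.
by move: h; rewrite distrC ltr_norml => /andP[_]; rewrite ltrBlDl.
Qed.

(** Continuity from below along a - 1 / (n + 1): the left limit is the mass of ]-oo, a[, which
    differs from the value at [a] by the atom. *)
Lemma spectral_cdf_left a e : 0 < e ->
  exists2 b, b < a &
    spectral_cdf a - rip F (P [set a] F) - e < spectral_cdf b.
Proof.
move=> e0; have [m mE] := spectral_distribution pvmP hF.
pose u n := a - n.+1%:R^-1.
have cup : \bigcup_n `]-oo, u n]%classic = `]-oo, a[%classic.
  apply/seteqP; split => x /=; rewrite ?in_itv/=.
    by move=> [n _] /=; rewrite in_itv/= => /le_lt_trans; apply; rewrite ltrBlDr ltrDl.
  move=> xa; have [n hn] := ltr_add_invr xa.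
  by exists n => //=; rewrite in_itv/= lerBrDr ltW.
have cv : (m \o (fun n => `]-oo, u n]%classic)) @ \oo --> m `]-oo, a[%classic.
  rewrite -cup; apply: nondecreasing_cvg_mu => //.
  - by rewrite cup.
  - move=> i j ij; apply/subsetPset => x /=; rewrite !in_itv/= => /le_trans; apply.
    by rewrite lerD2l lerN2 lef_pV2 ?posrE// ler_nat.
have aE : `]-oo, a]%classic = `]-oo, a[%classic `|` [set a].
  apply/seteqP; split => x /=; rewrite !in_itv/=.
    by rewrite le_eqVlt => /predU1P[->|]; [right|left].
  by move=> [/ltW//|->].
have -> : spectral_cdf a = rip F (P `]-oo, a[%classic F) + rip F (P [set a] F).
  rewrite /spectral_cdf aE (rip_pvm_setU pvmP)//.
  by apply/seteqP; split=> x //= [+ xa]; rewrite xa in_itv/= ltxx.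
have /cvgrPdist_lt/(_ _ e0) := spectral_cvg mE (fun n => mle (u n)) (mlt a) cv.
case => N _ /(_ N (leqnn N)) /= h; exists (u N); first by rewrite ltrBlDr ltrDl.
rewrite addrK; move: h; rewrite ltr_norml => /andP[_ h].
by rewrite ltrBlDr -ltrBlDl.
Qed.

End Cdf.

(** Growth rates of iterates separate only distinct energies, so a translate from the range of
    P(]-oo, a]) is shown to lie in the range of P(]-oo, b]) for every b > a; right continuity then
    closes the gap. *)
Lemma spectral_cdf_comp_le (e e' : T -> T) F a : cancel e e' -> cancel e' e ->
  (forall G, A (fun t => G (e t)) = fun t => A G (e t)) -> ell2 F ->
  spectral_cdf F a <= spectral_cdf (fun t => F (e t)) a.
Proof.
move=> ee' e'e Ae hF.
have be : bijective e by exists e'.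
have hFe := ell2_comp be hF.
(* The norm bound on the range needs 0 <= a; below 0 there is no spectrum. *)
have [a0|a0] := ltP a 0.
  by rewrite /spectral_cdf !pvm_neg// !rip0r.
apply/ler_addgt0Pr => d /(spectral_cdf_right hFe a)[b ab bd].
apply: le_trans (ltW bd).
pose G := P `]-oo, a]%classic F.
have hG : ell2 G by exact: PL2.
have hGe := ell2_comp be hG.
have b0 : 0 < b by exact: le_lt_trans ab.
have PGe : P `]-oo, b]%classic (fun t => G (e t)) = (fun t => G (e t)).
  (* [H] is the part of the translate above [b]. Its iterates grow at least like b^n, yet they are
     projections of translates of the iterates of [G], which grow at most like a^n. *)
  apply: pvm_le_id => //; set H := P _ _.
  have hH : ell2 H by exact: PL2.
  apply: rip_eq0 => //.
  pose Gn n := iter n A G; pose Hn n := iter n A H.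
  have hGn n : ell2 (Gn n) by elim: n => //= n IH; exact: AL2.
  have hHn n : ell2 (Hn n) by elim: n => //= n IH; exact: AL2.
  have PGn n : P `]-oo, a]%classic (Gn n) = Gn n.
    elim: n => [|n IH] /=; first by rewrite (pvm_idem pvmP).
    by rewrite (pvm_op opA spec)// -/(Gn n) IH.
  have HGn n : Hn n = P `]b, +oo[%classic (fun t => Gn n (e t)).
    elim: n => [//|n IH]; rewrite [LHS]/= -/(Hn n) IH.
    by rewrite -(pvm_op opA spec) ?Ae//; exact: ell2_comp.
  have PHn n : P `]b, +oo[%classic (Hn n) = Hn n.
    by rewrite HGn (pvm_idem pvmP)//; exact: ell2_comp.
  have up n : rip (Gn n) (Gn n) <= (a ^+ 2) ^+ n * rip G G.
    elim: n => [|n IH]; first by rewrite expr0 mul1r.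
    rewrite exprS -mulrA; apply: le_trans (op_norm_le a0 (hGn n) (PGn n)) _.
    by rewrite ler_wpM2l ?sqr_ge0.
  have lo n : (b ^+ 2) ^+ n * rip H H <= rip (Hn n) (Hn n).
    elim: n => [|n IH]; first by rewrite expr0 mul1r.
    rewrite exprS -mulrA; apply: le_trans (op_norm_ge (ltW b0) (hHn n) (PHn n)).
    by rewrite ler_wpM2l ?sqr_ge0.
  apply: (@powers_le (a ^+ 2) (b ^+ 2) (rip G G)); rewrite ?sqr_ge0 ?rip_ge0//.
    by rewrite ltr_pXn2r// nnegrE// ltW.
  move=> n; apply: le_trans (lo n) _; apply: le_trans (up n).
  have hGne := ell2_comp be (hGn n).
  rewrite HGn -(rip_pvm pvmP)//; apply: le_trans (rip_pvm_le pvmP _ _) _ => //.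
  by rewrite (rip_comp _ _ be).
have GE : rip G G = spectral_cdf F a by rewrite /spectral_cdf (rip_pvm pvmP).
(* |G|^2 = (G o e, F o e) = (G o e, P(]-oo, b]) (F o e)) <= |G| |P(]-oo, b]) (F o e)|, squared. *)
have : spectral_cdf F a ^+ 2 <= spectral_cdf F a * spectral_cdf (fun t => F (e t)) b.
  have {1}-> : spectral_cdf F a = rip (fun t => G (e t)) (P `]-oo, b]%classic (fun t => F (e t))).
    by rewrite (pvm_adj pvmP)// PGe (rip_comp _ _ be) ripC.
  have hPF := PL2 (mle b) hFe.
  apply: le_trans (CauchySchwarz_rip hGe hPF) _.
  by rewrite (rip_comp _ _ be) GE -(rip_pvm pvmP).
have : 0 <= spectral_cdf F a by rewrite -GE rip_ge0.
rewrite le_eqVlt => /predU1P[<- _|p0]; last by rewrite expr2 ler_pM2l.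
exact: (rip_pvm_ge0 pvmP).
Qed.

(** The reverse inequality is the previous one for the inverse map, which commutes with [A] as
    well. *)
Lemma spectral_cdf_comp (e e' : T -> T) F a : cancel e e' -> cancel e' e ->
  (forall G, A (fun t => G (e t)) = fun t => A G (e t)) -> ell2 F ->
  spectral_cdf (fun t => F (e t)) a = spectral_cdf F a.
Proof.
move=> ee' e'e Ae hF; apply/eqP; rewrite eq_le (spectral_cdf_comp_le _ ee' e'e)//.
rewrite andbT; have be : bijective e by exists e'.
have Ae' G : A (fun t => G (e' t)) = fun t => A G (e' t).
  have h := Ae (fun t => G (e' t)).
  apply/funext => t; have := congr1 (@^~ (e' t)) h; rewrite /= e'e => <-.
  by congr (A _ _); apply/funext => s; rewrite ee'.
have h := spectral_cdf_comp_le a e'e ee' Ae' (ell2_comp be hF).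
apply: le_trans h _.
suff -> : (fun t => F (e (e' t))) = F by [].
by apply/funext => t; rewrite e'e.
Qed.

(** On the range of P({c}) the form of [A] is [c] times the squared norm. D = A F - c F lies in this
    range too, and polarising at F + D yields (D, A F) = c (D, F), that is (D, D) = 0. *)
Lemma pvm_set1_eigen c F : ell2 F -> P [set c] F = F ->
  A F = fun t => c%:C%C * F t.
Proof.
move=> hF PF.
have form G : ell2 G -> P [set c] G = G -> rip G (A G) = c * rip G G.
  move=> hG PG; apply/eqP; rewrite eq_le.
  rewrite (form_le spec (m1 c))//; last by move=> x ->/=.
  by rewrite (form_ge spec (m1 c))// => x -> /=.
have hA := AL2 hF; have hcF : ell2 (fun t => c%:C%C * F t) by exact: ell2_scale.
pose D t := A F t - c%:C%C * F t.
have hD : ell2 D by exact: ell2_sub.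
have PcF : P [set c] (fun t => c%:C%C * F t) = fun t => c%:C%C * F t.
  have := pvm_lin pvmP c%:C%C (m1 c) hF (@ell2_zero R T).
  rewrite (pvm_0 pvmP (m1 c)) PF.
  rewrite (_ : (fun t => c%:C%C * F t + 0) = (fun t => c%:C%C * F t)) => [->//|].
  by apply/funext => t; rewrite addr0.
have PD : P [set c] D = D by rewrite (pvmB pvmP)// (pvm_op opA spec)// PF PcF.
have PS : P [set c] (fun t => F t + D t) = fun t => F t + D t.
  by rewrite (pvmD pvmP)// PF PD.
have hAD := AL2 hD.
have hS := ell2_add hF hD; have := form _ hS PS.
rewrite (opD opA) (ripDr hS hA hAD) (ripDl hA hF hD) (ripDl hAD hF hD).
rewrite (ripDr hS hF hD) (ripDl hF hF hD) (ripDl hD hF hD).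
have -> : rip F (A D) = rip D (A F) by rewrite (op_sym opA)// ripC.
rewrite (form _ hF PF) (form _ hD PD) [rip F D]ripC => h.
have DD : rip D D = 0.
  by rewrite (ripBr hD hA hcF) (ripZr _ hD hF); lra.
apply/funext => t; have := congr1 (@^~ t) (rip_eq0 hD DD) => /eqP.
by rewrite /D /= subr_eq0 => /eqP.
Qed.

(** Each [P B F] is again an eigenfunction, so the form bounds exclude mass strictly below and
    strictly above [c]: the distribution function of [F] jumps from 0 to |F|^2 at [c]. *)
Lemma eigen_pvm_set1 c F : ell2 F -> A F = (fun t => c%:C%C * F t) ->
  P [set c] F = F.
Proof.
move=> hF AF.
have AP B : measurable B -> A (P B F) = fun t => c%:C%C * P B F t.
  move=> mB; rewrite -(pvm_op opA spec)// AF.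
  have := pvm_lin pvmP c%:C%C mB hF (@ell2_zero R T).
  rewrite (pvm_0 pvmP mB).
  rewrite (_ : (fun t => c%:C%C * F t + 0) = (fun t => c%:C%C * F t)) => [->|].
    by apply/funext => t; rewrite addr0.
  by apply/funext => t; rewrite addr0.
have form B : measurable B -> rip (P B F) (A (P B F)) = c * rip (P B F) (P B F).
  by move=> mB; rewrite AP// ripZr//; exact: PL2.
have lo b : b < c -> spectral_cdf F b = 0.
  move=> bc; rewrite /spectral_cdf (rip_pvm pvmP)//.
  have sub : `]-oo, b]%classic `<=` [set x | x <= b] by move=> x /=; rewrite in_itv.
  have := form_le spec (mle b) (PL2 (mle b) hF) (pvm_idem pvmP (mle b) hF) sub.
  rewrite form// -subr_ge0 -mulrBl nmulr_rge0 ?subr_lt0// => h.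
  by apply/eqP; rewrite eq_le h rip_ge0.
have hi b : c < b -> spectral_cdf F b = rip F F.
  move=> cb; rewrite /spectral_cdf pvm_le_id//; apply: rip_eq0; first exact: PL2.
  have sub : `]b, +oo[%classic `<=` [set x | b <= x].
    by move=> x /=; rewrite in_itv/= andbT => /ltW.
  have := form_ge spec (mgt b) (PL2 (mgt b) hF) (pvm_idem pvmP (mgt b) hF) sub.
  rewrite form// -subr_ge0 -mulrBl nmulr_rge0 ?subr_lt0// => h.
  by apply/eqP; rewrite eq_le h rip_ge0.
apply: (pvm_id_rip pvmP) => //; apply/eqP.
rewrite eq_le (rip_pvm_le pvmP)//=; apply/ler_addgt0Pr => e e0.
have e20 : 0 < e / 2 by rewrite divr_gt0.
have [b cb] := spectral_cdf_right hF c e20; rewrite (hi b cb).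
have [b' b'c] := spectral_cdf_left hF c e20; rewrite (lo b' b'c).
lra.
Qed.

End SpectralProjections.

Section MoreSpectral.
Context {R : realType} {T : choiceType}.
Context {A : (T -> R[i]) -> T -> R[i]} (opA : is_pos_op A).
Context {P : set R -> (T -> R[i]) -> T -> R[i]} (spec : is_spectral_measure A P).
Let pvmP : is_bounded_pvm P := spec.1.
Local Notation cdf := (@spectral_cdf R T P).

Lemma spectral_cdf_jump_le F a b : ell2 F -> b < a ->
  cdf F b + rip F (P [set a] F) <= cdf F a.
Proof.
move=> hF ba.
have mb : measurable `]-oo, b]%classic by exact: measurable_itv.
have ma : measurable [set a] by exact: measurable_set1.
have disj : `]-oo, b]%classic `&` [set a] = set0.
  by apply/seteqP; split=> x //= [+ xa]; rewrite xa in_itv/= leNgt ba.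
rewrite /spectral_cdf -(rip_pvm_setU pvmP mb ma hF disj).
apply: (pvm_mono pvmP) => //; first exact: measurableU.
move=> x [|->]; rewrite /= !in_itv/= ?lexx// => /le_trans; apply; exact: ltW.
Qed.

(** An atom is recovered from the distribution function as its jump, between [spectral_cdf_jump_le]
    and [spectral_cdf_left]. *)
Lemma rip_pvm_set1_comp (e e' : T -> T) F a : cancel e e' -> cancel e' e ->
  (forall G, A (fun t => G (e t)) = fun t => A G (e t)) -> ell2 F ->
  rip (fun t => F (e t)) (P [set a] (fun t => F (e t))) = rip F (P [set a] F).
Proof.
move=> ee' e'e Ae hF.
have hFe : ell2 (fun t => F (e t)) by apply: ell2_comp => //; exists e'.
have cdfE x := spectral_cdf_comp opA spec x ee' e'e Ae hF.
apply/eqP; rewrite eq_le; apply/andP; split; apply/ler_addgt0Pr => d d0.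
  have [b ba] := spectral_cdf_left spec hF a d0.
  have := spectral_cdf_jump_le hFe ba; rewrite !cdfE; lra.
have [b ba] := spectral_cdf_left spec hFe a d0.
have := spectral_cdf_jump_le hF ba; rewrite !cdfE; lra.
Qed.

(* Split F = F1 + F2 below and above the gap, and pair (A - c) F with F2 - F1. *)
Lemma spectral_gap (x y : R) F : x < y -> ell2 F ->
  P `]x, y]%classic F = (fun=> 0) ->
  ((y - x) / 2) ^+ 2 * rip F F <=
  rip (fun t => A F t - ((x + y) / 2)%:C%C * F t)
      (fun t => A F t - ((x + y) / 2)%:C%C * F t).
Proof.
move=> xy hF gap; set c := (x + y) / 2; set e := (y - x) / 2.
have mx : measurable `]-oo, x]%classic by exact: measurable_itv.
have my : measurable `]y, +oo[%classic by exact: measurable_itv.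
have myx : measurable `]x, y]%classic by exact: measurable_itv.
pose F1 := P `]-oo, x]%classic F; pose F2 := P `]y, +oo[%classic F.
have hF1 : ell2 F1 by exact: (pvm_ell2 pvmP).
have hF2 : ell2 F2 by exact: (pvm_ell2 pvmP).
have [hAF hA1 hA2] : [/\ ell2 (A F), ell2 (A F1) & ell2 (A F2)].
  by split; exact: (op_ell2 opA).
have FE : F = fun t => F1 t + F2 t.
  have cov : ~` `]-oo, x]%classic = `]x, y]%classic `|` `]y, +oo[%classic.
    rewrite setCitvl; apply/seteqP; split=> z /=; rewrite !in_itv/= ?andbT.
      by move=> xz; have [zy|yz] := leP z y; [left|right]; rewrite ?xz.
    by case=> [/andP[]//|]; exact: lt_trans.
  rewrite [LHS](pvm_setC pvmP mx hF) cov (pvm_setU pvmP)//.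
    by rewrite gap; apply/funext => t; rewrite add0r.
  by apply/seteqP; split=> z //=; rewrite !in_itv/= andbT => -[/andP[_]]; rewrite leNgt => /negP.
have xy0 : `]-oo, x]%classic `&` `]y, +oo[%classic = set0.
  apply/seteqP; split=> z //=; rewrite !in_itv/= andbT => -[zx yz].
  by have := lt_trans xy (lt_le_trans yz zx); rewrite ltxx.
have r12 : rip F1 F2 = 0.
  by rewrite /F1 -(pvm_adj pvmP)// (pvm_disjoint pvmP)// rip0r.
have a12 : rip F1 (A F2) = 0 by exact: (form_disjoint opA spec).
have a21 : rip F2 (A F1) = 0 by rewrite (op_sym opA)// ripC.
have f1 : rip F1 (A F1) <= x * rip F1 F1.
  have sub : `]-oo, x]%classic `<=` [set z | z <= x] by move=> z /=; rewrite in_itv.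
  exact: (form_le spec mx hF1 (pvm_idem pvmP mx hF) sub).
have f2 : y * rip F2 F2 <= rip F2 (A F2).
  have sub : `]y, +oo[%classic `<=` [set z | y <= z].
    by move=> z /=; rewrite in_itv/= andbT => /ltW.
  exact: (form_ge spec my hF2 (pvm_idem pvmP my hF) sub).
pose J t := F2 t - F1 t.
have hJ : ell2 J by exact: ell2_sub.
have JJ : rip J J = rip F F.
  rewrite FE (ripBr hJ hF2 hF1) (ripBl hF2 hF2 hF1) (ripBl hF1 hF2 hF1).
  have hS := ell2_add hF1 hF2.
  rewrite (ripDr hS hF1 hF2) (ripDl hF1 hF1 hF2) (ripDl hF2 hF1 hF2).
  by rewrite [rip F2 F1]ripC r12; ring.
have FF : rip F F = rip F1 F1 + rip F2 F2.
  rewrite FE; have hS := ell2_add hF1 hF2.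
  rewrite (ripDr hS hF1 hF2) (ripDl hF1 hF1 hF2) (ripDl hF2 hF1 hF2).
  by rewrite [rip F2 F1]ripC r12; ring.
have hcF : ell2 (fun t => c%:C%C * F t) by exact: ell2_scale.
set D := fun t => A F t - c%:C%C * F t.
have hD : ell2 D by exact: ell2_sub.
have JD : e * rip F F <= rip J D.
  rewrite /D (ripBr hJ hAF hcF) (ripZr _ hJ hF).
  have -> : rip J (A F) = rip F2 (A F2) - rip F1 (A F1).
    rewrite {1}FE (opD opA) (ripDr hJ hA1 hA2).
    by rewrite (ripBl hA1 hF2 hF1) (ripBl hA2 hF2 hF1) a12 a21; ring.
  have -> : rip J F = rip F2 F2 - rip F1 F1.
    rewrite {1}FE (ripDr hJ hF1 hF2).
    by rewrite (ripBl hF1 hF2 hF1) (ripBl hF2 hF2 hF1) [rip F2 F1]ripC r12; ring.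
  rewrite FF /c /e; have := rip_ge0 F1; have := rip_ge0 F2; nra.
have cs := CauchySchwarz_rip hJ hD; rewrite JJ in cs.
have F0 := rip_ge0 F; have [->|nF] := eqVneq (rip F F) 0.
  by rewrite mulr0 rip_ge0.
have e0 : 0 <= e by rewrite divr_ge0// subr_ge0 ltW.
have : (e * rip F F) ^+ 2 <= rip F F * rip D D.
  have eF0 : 0 <= e * rip F F by exact: mulr_ge0.
  apply: le_trans cs; apply: lerXn2r => //.
  by rewrite nnegrE; exact: le_trans JD.
rewrite exprMn [rip F F ^+ 2]expr2 mulrA [leRHS]mulrC.
by rewrite ler_pM2r// lt0r nF.
Qed.

End MoreSpectral.

(** * Eigenfunctions on finite boxes *)

Section TriangleLaplacian.
Context {R : realType} {T : choiceType}.
Implicit Types (F G : T -> R[i]) (u d : T -> T).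

(* Every vertex lies in two triangles; u and d rotate all the triangles of one
   kind, so that the neighbours of t are u t, u (u t), d t and d (d t). *)
Definition tri_lap u d F : T -> R[i] :=
  fun t => F t - 4^-1 * (F (u t) + F (u (u t)) + F (d t) + F (d (d t))).

(** Three times the averaging over the orbits of [u]: symmetric because u^-1 = u^2, and with square
    three times itself, whence the bounds 0 and 3. *)
Let tri u F : T -> R[i] := fun t => F t + F (u t) + F (u (u t)).

Section Rotation.
Variables (u : T -> T) (u3 : forall t, u (u (u t)) = t).

Let bij_u : bijective u. Proof. by exists (u \o u). Qed.

Let tri_ell2 F : ell2 F -> ell2 (tri u F).
Proof.
move=> hF; have hu := ell2_comp bij_u hF; have huu := ell2_comp bij_u hu.
exact: ell2_add (ell2_add hF hu) huu.
Qed.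

Let tri_sym F G : ell2 F -> ell2 G -> rip F (tri u G) = rip (tri u F) G.
Proof.
move=> hF hG.
have hFu := ell2_comp bij_u hF; have hFuu := ell2_comp bij_u hFu.
have hGu := ell2_comp bij_u hG; have hGuu := ell2_comp bij_u hGu.
rewrite /tri (ripDr hF (ell2_add hG hGu) hGuu) (ripDr hF hG hGu).
rewrite (ripDl hG (ell2_add hF hFu) hFuu) (ripDl hG hF hFu).
have uK : cancel (u \o u) u by move=> t; exact: u3.
have uK' : cancel u (u \o u) by move=> t; exact: u3.
rewrite (rip_compl F G uK' uK : rip (fun t => F (u t)) G = rip F (fun t => G (u (u t)))).
rewrite (rip_compl F G uK uK' : rip (fun t => F (u (u t))) G = rip F (fun t => G (u t))).
by rewrite addrAC.
Qed.

Let tri_sqr F : ell2 F -> rip (tri u F) (tri u F) = 3 * rip F (tri u F).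
Proof.
move=> hF; have hU := tri_ell2 hF.
rewrite tri_sym//.
have -> : tri u (tri u F) = fun t => 3%:C%C * tri u F t.
  apply/funext => t; rewrite /tri !u3.
  have -> : 3%:C%C = 3 :> R[i] by rewrite rmorph_nat.
  by ring.
by rewrite (ripZl _ hF hU) ripC.
Qed.

Lemma rip_triangle_ge0 F : ell2 F -> 0 <= rip F (tri u F).
Proof.
move=> hF; have := rip_ge0 (tri u F); rewrite tri_sqr//.
by rewrite pmulr_rge0.
Qed.

Lemma rip_triangle_le F : ell2 F -> rip F (tri u F) <= 3 * rip F F.
Proof.
move=> hF; have hU := tri_ell2 hF; have := CauchySchwarz_rip hF hU.
rewrite tri_sqr//; have := rip_triangle_ge0 hF.
rewrite le_eqVlt => /predU1P[<- _|p0]; first by rewrite mulr_ge0 ?rip_ge0.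
by rewrite expr2 mulrA ler_pM2r// [leRHS]mulrC.
Qed.

Lemma rip_triangle_sym F G : ell2 F -> ell2 G -> rip F (tri u G) = rip (tri u F) G.
Proof. exact: tri_sym. Qed.

Lemma triangle_ell2 F : ell2 F -> ell2 (tri u F). Proof. exact: tri_ell2. Qed.

End Rotation.

Variables (u d : T -> T).
Hypotheses (u3 : forall t, u (u (u t)) = t) (d3 : forall t, d (d (d t)) = t).

Lemma tri_lapE F : tri_lap u d F =
  fun t => (3 / 2)%:C%C * F t + (- 4^-1)%:C%C * (tri u F t + tri d F t).
Proof.
apply/funext => t; rewrite /tri_lap /tri.
have -> : (3 / 2)%:C%C = 3 / 2 :> R[i] by rewrite rmorphM fmorphV !rmorph_nat.
have -> : (- 4^-1)%:C%C = - 4^-1 :> R[i] by rewrite rmorphN fmorphV rmorph_nat.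
by field.
Qed.

Let lap_ell2 F : ell2 F -> ell2 (tri_lap u d F).
Proof.
move=> hF; rewrite tri_lapE; apply: ell2_lin => //.
by apply: ell2_scale; apply: ell2_add; exact: triangle_ell2.
Qed.

Let rip_lap F G : ell2 F -> ell2 G -> rip F (tri_lap u d G) =
  3 / 2 * rip F G - 4^-1 * (rip F (tri u G) + rip F (tri d G)).
Proof.
move=> hF hG; have hU := triangle_ell2 u3 hG; have hD := triangle_ell2 d3 hG.
have hS := ell2_add hU hD; rewrite tri_lapE.
rewrite (ripDr hF (ell2_scale _ hG) (ell2_scale _ hS)) (ripZr _ hF hG) (ripZr _ hF hS).
by rewrite (ripDr hF hU hD) mulNr.
Qed.

Lemma tri_lap_pos : is_pos_op (tri_lap u d).
Proof.
split=> //.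
- by move=> a F G; apply/funext => t; rewrite /tri_lap; ring.
- move=> F G hF hG; rewrite [RHS]ripC (rip_lap hF hG) (rip_lap hG hF).
  have uE : rip F (tri u G) = rip G (tri u F).
    by rewrite (rip_triangle_sym u3 hF hG) [LHS]ripC.
  have dE : rip F (tri d G) = rip G (tri d F).
    by rewrite (rip_triangle_sym d3 hF hG) [LHS]ripC.
  by rewrite uE dE [rip F G]ripC.
- move=> F hF; rewrite rip_lap//.
  have := rip_triangle_le u3 hF; have := rip_triangle_le d3 hF; lra.
Qed.

Lemma tri_lap_le F : ell2 F -> rip F (tri_lap u d F) <= 3 / 2 * rip F F.
Proof.
move=> hF; rewrite rip_lap//.
have := rip_triangle_ge0 u3 hF; have := rip_triangle_ge0 d3 hF; lra.
Qed.

Lemma tri_lap_comp (e : T -> T) F : (forall t, u (e t) = e (u t)) ->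
  (forall t, d (e t) = e (d t)) ->
  tri_lap u d (fun t => F (e t)) = fun t => tri_lap u d F (e t).
Proof. by move=> ue de; apply/funext => t; rewrite /tri_lap !(ue, de). Qed.

End TriangleLaplacian.

(** * Trace of an eigenprojection over finitely many points *)

Section TraceBounds.
Context {R : realType} {T : choiceType}.
Context {A : (T -> R[i]) -> T -> R[i]} (opA : is_pos_op A).
Context {P : set R -> (T -> R[i]) -> T -> R[i]} (spec : is_spectral_measure A P).
Let pvmP : is_bounded_pvm P := spec.1.
Implicit Types F G : T -> R[i].
Local Notation Re := complex.Re.

Definition fin_comb (I : finType) (p : I -> T) (x : I -> R[i]) : T -> R[i] :=
  fun t => \sum_i x i * delta (p i) t.

Section FinComb.
Context {I : finType} (p : I -> T) (p_inj : injective p).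

Lemma fin_comb_ell2 x : ell2 (fin_comb p x).
Proof. by apply: ell2_sum => i; exact: ell2_delta. Qed.

Lemma fin_combE x i : fin_comb p x (p i) = x i.
Proof.
rewrite /fin_comb (bigD1 i)//= deltaE eqxx mulr1 big1 ?addr0// => j ji.
by rewrite deltaE (inj_eq p_inj) eq_sym (negbTE ji) mulr0.
Qed.

Lemma fin_comb_out x t : (forall i, t <> p i) -> fin_comb p x t = 0.
Proof.
move=> tp; rewrite /fin_comb big1// => i _; rewrite deltaE.
by case: eqP => [/tp//|_]; rewrite mulr0.
Qed.

Lemma rip_fin_comb x G : ell2 G ->
  rip (fin_comb p x) G = \sum_i Re (G (p i) * (x i)^*%C).
Proof.
move=> hG; rewrite /fin_comb.
elim: (index_enum I) => [|i r IH].
  rewrite big_nil (_ : (fun t => _) = fun=> 0) ?rip0l//.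
  by apply/funext => t; rewrite big_nil.
have hr : ell2 (fun t => \sum_(j <- r) x j * delta (p j) t).
  by apply: ell2_sum => j; exact: ell2_delta.
have hi : ell2 (fun t => x i * delta (p i) t) by apply: ell2_scale; exact: ell2_delta.
rewrite big_cons -IH.
have -> : Re (G (p i) * (x i)^*%C) = rip (fun t => x i * delta (p i) t) G.
  have -> : rip (fun t => x i * delta (p i) t) G =
      rip (delta (p i)) (fun t => (x i)^*%C * G t).
    congr rsum; apply/funext => t.
    by case: (x i) (delta (p i) t) (G t) => [a b] [c e] [f g] /=; ring.
  by rewrite rip_delta mulrC.
have -> : (fun t => \sum_(j <- i :: r) x j * delta (p j) t) =
    (fun t => x i * delta (p i) t + \sum_(j <- r) x j * delta (p j) t).
  by apply/funext => t; rewrite big_cons.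
exact: ripDl hG hi hr.
Qed.

Lemma pvm_fin_comb B x : measurable B ->
  P B (fin_comb p x) = fun t => \sum_i x i * P B (delta (p i)) t.
Proof.
move=> mB; rewrite /fin_comb.
elim: (index_enum I) => [|i r IH].
  rewrite [X in P B X](_ : _ = fun=> 0).
    by rewrite (pvm_0 pvmP)//; apply/funext => t; rewrite big_nil.
  by apply/funext => t; rewrite big_nil.
have hr : ell2 (fun t => \sum_(j <- r) x j * delta (p j) t).
  by apply: ell2_sum => j; exact: ell2_delta.
have -> : (fun t => \sum_(j <- i :: r) x j * delta (p j) t) =
    (fun t => x i * delta (p i) t + \sum_(j <- r) x j * delta (p j) t).
  by apply/funext => t; rewrite big_cons.
rewrite (pvm_lin pvmP _ mB (ell2_delta _) hr) IH.
by apply/funext => t; rewrite big_cons.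
Qed.

Lemma rip_fin_comb_self x :
  rip (fin_comb p x) (fin_comb p x) = \sum_i Re (x i * (x i)^*%C).
Proof.
rewrite rip_fin_comb; last exact: fin_comb_ell2.
by apply: eq_bigr => i _; rewrite fin_combE.
Qed.

Lemma rip_pvm_fin_comb B x : measurable B ->
  rip (fin_comb p x) (P B (fin_comb p x)) =
  Re (\sum_i \sum_j x i * P B (delta (p i)) (p j) * (x j)^*%C).
Proof.
move=> mB; rewrite rip_fin_comb; last by apply: (pvm_ell2 pvmP) => //; exact: fin_comb_ell2.
rewrite exchange_big Re_sum; apply: eq_bigr => j _; congr Re.
by rewrite pvm_fin_comb// mulr_suml.
Qed.

(* Delyon-Souillard: the trace of the projection over a finite set of points is
   at most the number of values which determine an eigenfunction on that set. *)
Lemma eigen_trace_le (J : finType) (s : J -> T) (c : R) :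
  (forall F, ell2 F -> A F = (fun t => c%:C%C * F t) ->
    (forall j, F (s j) = 0) -> forall i, F (p i) = 0) ->
  \sum_i rip (delta (p i)) (P [set c] (delta (p i))) <= #|J|%:R.
Proof.
move=> det; have mc : measurable [set c] by exact: measurable_set1.
under eq_bigr do rewrite rip_delta.
apply: (@Re_trace_le_card R I J (fun i j => P [set c] (delta (p i)) (p j))
  (fun i j => P [set c] (delta (p i)) (s j))) => x.
  rewrite -rip_pvm_fin_comb// -rip_fin_comb_self.
  by apply: (rip_pvm_le pvmP) => //; exact: fin_comb_ell2.
have hx := fin_comb_ell2 x.
have hE := pvm_ell2 pvmP mc hx.
have := det _ hE (pvm_set1_eigen opA spec hE (pvm_idem pvmP mc hx)).
by rewrite pvm_fin_comb.
Qed.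

(** The bound from below: combinations obeying the constraints are eigenfunctions, hence killed by
    the complement of P({c}), whose trace over the points is therefore at most the number of
    constraints. *)
Lemma eigen_trace_ge (J : finType) (f : T -> J -> R[i]) (c : R) :
  (forall x, (forall j, \sum_i x i * f (p i) j = 0) ->
    A (fin_comb p x) = (fun t => c%:C%C * fin_comb p x t)) ->
  #|I|%:R - #|J|%:R <= \sum_i rip (delta (p i)) (P [set c] (delta (p i))).
Proof.
move=> det; have mc : measurable [set c] by exact: measurable_set1.
under eq_bigr do rewrite rip_delta.
pose m i j : R[i] := (i == j)%:R - P [set c] (delta (p i)) (p j).
have mE (x : I -> R[i]) j :
    \sum_i x i * m i j = x j - P [set c] (fin_comb p x) (p j).
  rewrite pvm_fin_comb//; under eq_bigr do rewrite mulrBr.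
  rewrite sumrB; congr (_ - _); rewrite (bigD1 j)//= eqxx mulr1 big1 ?addr0//.
  by move=> i /negbTE ->; rewrite mulr0.
have := @Re_trace_le_card R I J m (fun i j => f (p i) j).
have -> : \sum_i Re (m i i) = #|I|%:R - \sum_i Re (P [set c] (delta (p i)) (p i)).
  rewrite -sum1_card natr_sum -sumrB; apply: eq_bigr => i _.
  by rewrite /m eqxx; case: (P _ _ _).
suff h : forall a b c : R, a - b <= c -> a - c <= b.
  move=> tr; apply: h; apply: tr => x; last first.
    move=> /det Ax k; rewrite mE.
    by rewrite (eigen_pvm_set1 opA spec (fin_comb_ell2 x) Ax) fin_combE subrr.
  rewrite -rip_fin_comb_self exchange_big /= Re_sum.
  have -> : \sum_i Re (\sum_j x j * m j i * (x i)^*%C) =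
      rip (fin_comb p x) (fin_comb p x) - rip (fin_comb p x) (P [set c] (fin_comb p x)).
    rewrite rip_fin_comb_self rip_fin_comb; last first.
      by apply: (pvm_ell2 pvmP) => //; exact: fin_comb_ell2.
    rewrite -sumrB; apply: eq_bigr => i _.
    rewrite -mulr_suml mE mulrBl.
    by case: (x i * _) (P _ _ _ * _) => [? ?] [? ?].
  rewrite gerBl; apply: (rip_pvm_ge0 pvmP) => //; exact: fin_comb_ell2.
by move=> a b e; lra.
Qed.

End FinComb.
End TraceBounds.

(** * Cells, corners and rotations of the triangles *)

Variant corner := Ca | Cb | Cc.

Definition corner_code (k : corner) : option bool :=
  match k with Ca => None | Cb => Some true | Cc => Some false end.
Definition corner_decode (o : option bool) : corner :=
  match o with None => Ca | Some true => Cb | Some false => Cc end.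
Lemma corner_codeK : cancel corner_code corner_decode. Proof. by case. Qed.
HB.instance Definition _ := Finite.copy corner (can_type corner_codeK).

Lemma card_corner : #|{: corner}| = 3%N.
Proof.
have bij : bijective corner_code by exists corner_decode => //; do 2?case.
by rewrite (bij_eq_card bij) card_option card_bool.
Qed.

Lemma sum_corner (V : nmodType) (f : corner -> V) :
  \sum_k f k = f Ca + f Cb + f Cc.
Proof.
rewrite (bigD1 Ca)//= (bigD1 Cb)//= (bigD1 Cc)//= big1 ?addr0 ?addrA//.
by case.
Qed.

Section CornerCells.

Definition cell_site : Type := int * int * corner.

(* (x, y, Ca), (x, y, Cb), (x, y, Cc) are the vertices 2xw1+2yw2, w1+2xw1+2yw2,
   w2+2xw1+2yw2; [up] rotates the triangle with these three corners, [dn] the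
   triangles meeting three different cells. *)
Definition up (v : cell_site) : cell_site :=
  let: (x, y, k) := v in
  match k with Ca => (x, y, Cb) | Cb => (x, y, Cc) | Cc => (x, y, Ca) end.

Definition dn (v : cell_site) : cell_site :=
  let: (x, y, k) := v in
  match k with
  | Ca => (x - 1, y, Cb) | Cb => (x + 1, y - 1, Cc) | Cc => (x, y + 1, Ca)
  end.

Definition cell_shift (a b : int) (v : cell_site) : cell_site :=
  let: (x, y, k) := v in (x + a, y + b, k).

Lemma up3 v : up (up (up v)) = v. Proof. by case: v => [[x y] []]. Qed.

Lemma dn3 v : dn (dn (dn v)) = v.
Proof. by case: v => [[x y] []] /=; rewrite ?addrK ?subrK. Qed.

Lemma up_cell_shift a b v : up (cell_shift a b v) = cell_shift a b (up v).
Proof. by case: v => [[x y] []]. Qed.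

Lemma dn_cell_shift a b v : dn (cell_shift a b v) = cell_shift a b (dn v).
Proof.
by case: v => [[x y] []] /=; congr (_, _, _); rewrite // addrAC.
Qed.

Lemma shiftK a b : cancel (cell_shift a b) (cell_shift (- a) (- b)).
Proof. by case=> [[x y] k] /=; rewrite !addrK. Qed.

Lemma shiftNK a b : cancel (cell_shift (- a) (- b)) (cell_shift a b).
Proof. by case=> [[x y] k] /=; rewrite !subrK. Qed.

End CornerCells.

(** * The model on a set in bijection with the cell sites *)

Section KagomeModel.
Context {R : realType} {T : choiceType}.
Context (iota : cell_site -> T) (kappa : T -> cell_site).
Context (ik : cancel iota kappa) (ki : cancel kappa iota).
Implicit Types F G : T -> R[i].

Definition tup t := iota (up (kappa t)).
Definition tdn t := iota (dn (kappa t)).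
Definition tshift a b t := iota (cell_shift a b (kappa t)).

Lemma tup3 t : tup (tup (tup t)) = t. Proof. by rewrite /tup !ik up3 ki. Qed.
Lemma tdn3 t : tdn (tdn (tdn t)) = t. Proof. by rewrite /tdn !ik dn3 ki. Qed.

Lemma tup_iota v : tup (iota v) = iota (up v). Proof. by rewrite /tup ik. Qed.
Lemma tdn_iota v : tdn (iota v) = iota (dn v). Proof. by rewrite /tdn ik. Qed.

Lemma tup_cell_shift a b t : tup (tshift a b t) = tshift a b (tup t).
Proof. by rewrite /tup /tshift !ik up_cell_shift. Qed.

Lemma tdn_cell_shift a b t : tdn (tshift a b t) = tshift a b (tdn t).
Proof. by rewrite /tdn /tshift !ik dn_cell_shift. Qed.

Lemma tshiftK a b : cancel (tshift a b) (tshift (- a) (- b)).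
Proof. by move=> t; rewrite /tshift ik shiftK ki. Qed.

Lemma tshiftNK a b : cancel (tshift (- a) (- b)) (tshift a b).
Proof. by move=> t; rewrite /tshift ik shiftNK ki. Qed.

Local Notation A := (@tri_lap R T tup tdn).

Lemma kagome_op : is_pos_op A. Proof. exact: tri_lap_pos tup3 tdn3. Qed.

Context {P : set R -> (T -> R[i]) -> T -> R[i]} (spec : is_spectral_measure A P).
Let pvmP : is_bounded_pvm P := spec.1.

Local Notation cdf := (@spectral_cdf R T P).

Lemma kagome_shift a b F : A (fun t => F (tshift a b t)) = fun t => A F (tshift a b t).
Proof. by apply: tri_lap_comp => t; rewrite ?tup_cell_shift ?tdn_cell_shift. Qed.

Lemma delta_shift (x y : int) k :
  delta (iota (x, y, k)) = fun t => delta (iota (0, 0, k)) (tshift (- x) (- y) t) :> R[i].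
Proof.
apply/funext => t; rewrite !deltaE; congr (_%:R); congr (nat_of_bool _).
apply/eqP/eqP => [->|/(congr1 (tshift x y))]; first by rewrite /tshift ik /= !addrN.
by rewrite tshiftNK => ->; rewrite /tshift ik /= !add0r.
Qed.

Lemma kagome_cdf_shift x y k c :
  cdf (delta (iota (x, y, k))) c = cdf (delta (iota (0, 0, k))) c.
Proof.
rewrite delta_shift.
have K : cancel (tshift (- x) (- y)) (tshift x y) by exact: tshiftNK.
have K' : cancel (tshift x y) (tshift (- x) (- y)) by exact: tshiftK.
by apply: (spectral_cdf_comp kagome_op spec c K K' (kagome_shift _ _)); exact: ell2_delta.
Qed.

Lemma kagome_pvm1_shift x y k c :
  rip (delta (iota (x, y, k))) (P [set c] (delta (iota (x, y, k)))) =
  rip (delta (iota (0, 0, k))) (P [set c] (delta (iota (0, 0, k)))).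
Proof.
rewrite delta_shift.
have K : cancel (tshift (- x) (- y)) (tshift x y) by exact: tshiftNK.
have K' : cancel (tshift x y) (tshift (- x) (- y)) by exact: tshiftK.
by apply: (rip_pvm_set1_comp kagome_op spec c K K' (kagome_shift _ _)); exact: ell2_delta.
Qed.

Definition box_pt n (i : 'I_n * 'I_n * corner) : T :=
  iota (i.1.1%:Z, i.1.2%:Z, i.2).

Lemma box_pt_inj n : injective (@box_pt n).
Proof.
move=> [[x y] k] [[x' y'] k'] /(can_inj ik) [xx yy ->].
by congr (_, _, _); apply: val_inj.
Qed.

Lemma sum_box (f : corner -> R) n :
  \sum_(i : 'I_n * 'I_n * corner) f i.2 = n%:R ^+ 2 * \sum_k f k.
Proof.
rewrite -(pair_bigA _ (fun (p : 'I_n * 'I_n) k => f k))/=.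
by rewrite sumr_const card_prod card_ord -[LHS]mulr_natl natrM expr2.
Qed.

Definition eigen_mass c :=
  \sum_k rip (delta (iota (0, 0, k))) (P [set c] (delta (iota (0, 0, k)))).

Lemma box_trace n c :
  \sum_(i : 'I_n * 'I_n * corner) rip (delta (box_pt i)) (P [set c] (delta (box_pt i))) =
  n%:R ^+ 2 * eigen_mass c.
Proof.
rewrite -(sum_box (fun k => rip (delta (iota (0, 0, k))) (P [set c] (delta (iota (0, 0, k)))))).
by apply: eq_bigr => -[[x y] k] _ /=; rewrite /box_pt /= kagome_pvm1_shift.
Qed.

Section Determination.
Variables (c : R) (F : T -> R[i]).
Hypothesis eigenF : A F = fun t => c%:C%C * F t.
(** The eigenvalue equation says that the two triangle sums at a vertex add up to (6 - 4 c) F; the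
    flat band is the case 6 - 4 c = 0. Below, [U x y] and [D x y] are the sums over the up- and the
    down-triangle with corner [Ca] in the cell (x, y). *)
Let mu : R[i] := (6 - 4 * c)%:C%C.
Let f x y k := F (iota (x, y, k)).
Let U x y := f x y Ca + f x y Cb + f x y Cc.
Let D x y := f x y Ca + f (x - 1) y Cb + f x (y - 1) Cc.

Let eigenE t : mu * F t =
  (F t + F (tup t) + F (tup (tup t))) + (F t + F (tdn t) + F (tdn (tdn t))).
Proof.
have := congr1 (@^~ t) eigenF; rewrite /tri_lap => e.
have -> : mu = 6 - 4 * c%:C%C by rewrite /mu rmorphB rmorphM !rmorph_nat.
rewrite mulrBl -mulrA -e; by field.
Qed.

Lemma eigen_a x y : mu * f x y Ca = U x y + D x y.
Proof.
rewrite /f eigenE !(tup_iota, tdn_iota) /= /U /D /f.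
by rewrite subrK; congr (_ + _).
Qed.

Lemma eigen_b x y : mu * f x y Cb = U x y + D (x + 1) y.
Proof.
rewrite /f eigenE !(tup_iota, tdn_iota) /= /U /D /f.
by rewrite subrK addrK; ring.
Qed.

Lemma eigen_c x y : mu * f x y Cc = U x y + D x (y + 1).
Proof.
rewrite /f eigenE !(tup_iota, tdn_iota) /= /U /D /f.
by rewrite addrK; ring.
Qed.

(** Summation over a triangle leaves equations between the triangle sums alone: an eigenvalue
    equation on the hexagonal lattice, whose vertices are the triangles. *)
Let sumU x y : mu * U x y = 3 * U x y + D x y + D (x + 1) y + D x (y + 1).
Proof.
have -> : mu * U x y = mu * f x y Ca + mu * f x y Cb + mu * f x y Cc.
  by rewrite /U !mulrDr.
by rewrite eigen_a eigen_b eigen_c; ring.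
Qed.

Let sumD x y : mu * D x y = 3 * D x y + U x y + U (x - 1) y + U x (y - 1).
Proof.
have -> : mu * D x y = mu * f x y Ca + mu * f (x - 1) y Cb + mu * f x (y - 1) Cc.
  by rewrite /D !mulrDr.
by rewrite eigen_a eigen_b eigen_c !subrK; ring.
Qed.

Variable n : nat.
Hypothesis F_left : forall i k, (i < n)%N -> f 0 i%:Z k = 0.
Hypothesis F_right : forall i k, (i < n)%N -> f n.-1%:Z i%:Z k = 0.
Hypothesis F_bottom : forall i k, (i < n)%N -> f i%:Z 0 k = 0.

Let cell0 x y : (forall k, f x y k = 0) -> U x y = 0 /\ D x y = 0.
Proof.
move=> h; have U0 : U x y = 0 by rewrite /U !h !addr0.
split=> //; have := eigen_a x y; rewrite h U0 mulr0 add0r; exact/esym.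
Qed.

Let intSB (m : nat) : m.+1%:Z - 1 = m%:Z. Proof. by rewrite -addn1 PoszD addrK. Qed.
Let intSD (m : nat) : m%:Z + 1 = m.+1%:Z. Proof. by rewrite -addn1 PoszD. Qed.

(** The equations for [U] and [D] form an upward recursion. [sumU] at (x + 1, y) yields D (x + 1) (y
    + 1) from the row below; as it involves D (x + 2) y, the right column has to be prescribed.
    [sumD] then yields U (x + 1) (y + 1) from the left and lower neighbours. *)
Lemma eigen_determined : c != 3 / 2 ->
  forall x y k, (x < n)%N -> (y < n)%N -> f x%:Z y%:Z k = 0.
Proof.
move=> c32.
have mu0 : mu != 0.
  rewrite /mu -(inj_eq (@complexI R)) in c32 *.
  apply: contra c32 => /eqP/complexI h; apply/eqP; congr (_%:C)%C; lra.
have UD y : (y < n)%N -> forall x, (x < n)%N -> U x%:Z y%:Z = 0 /\ D x%:Z y%:Z = 0.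
  elim: y => [|y IHy] yn; first by move=> x xn; apply: cell0 => k; exact: F_bottom.
  elim=> [|x IHx] xn; first by apply: cell0 => k; exact: F_left.
  have [xn1|xn1] := eqVneq x.+1 n.-1.
    by apply: cell0 => k; rewrite xn1; exact: F_right.
  have x2n : (x.+2 < n)%N by lia.
  have yn' : (y < n)%N by exact: ltnW.
  have [U1 D1] := IHy yn' _ xn; have [U2 D2] := IHy yn' _ x2n.
  have [U3 _] := IHx (ltnW xn).
  have D0 : D x.+1%:Z y.+1%:Z = 0.
    have := sumU x.+1%:Z y%:Z; rewrite U1 D1 !intSD D2 !mulr0 !add0r; exact/esym.
  split=> //; have := sumD x.+1%:Z y.+1%:Z; rewrite D0 !intSB U1 U3 !mulr0 !addr0 add0r.
  exact/esym.
move=> x y k xn yn; have [U0 D0] := UD y yn x xn.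
(* As [mu] is nonzero, vertex values are recovered from triangle sums. In the last column, where D
   (x + 1) y is out of reach, the value at [Cb] is prescribed. *)
have a0 : f x%:Z y%:Z Ca = 0.
  have /eqP := eigen_a x%:Z y%:Z; rewrite U0 D0 addr0 mulf_eq0 (negbTE mu0) => /eqP.
  by [].
have b0 : f x%:Z y%:Z Cb = 0.
  have [xn1|xn1] := eqVneq x n.-1; first by rewrite xn1; exact: F_right.
  have [|_ D1] := UD y yn x.+1; first by lia.
  have /eqP := eigen_b x%:Z y%:Z; rewrite intSD U0 D1 addr0 mulf_eq0 (negbTE mu0) => /eqP.
  by [].
case: k => //; by move: U0; rewrite /U a0 b0 !add0r.
Qed.

(* For the flat band the sums over all the triangles vanish, so that the values
   at the corners Ca and on the boundary determine the others. *)
Lemma flat_band_determined : c = 3 / 2 ->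
  (forall x y, (x < n)%N -> (y < n)%N -> f x%:Z y%:Z Ca = 0) ->
  forall x y k, (x < n)%N -> (y < n)%N -> f x%:Z y%:Z k = 0.
Proof.
move=> c32 F_a.
have mu0 : mu = 0 by rewrite /mu c32; congr (_%:C)%C; field.
(* With mu = 0, triangles sharing a vertex have opposite sums, so all down-triangles have the same
   sum, which is 0 at the corner of the box. *)
have Dr x y : D (x + 1) y = D x y.
  have := eigen_a x y; have := eigen_b x y; rewrite mu0 !mul0r => -> /addrI; exact.
have Du x y : D x (y + 1) = D x y.
  have := eigen_a x y; have := eigen_c x y; rewrite mu0 !mul0r => -> /addrI; exact.
case: (posnP n) => [n0 x y k|n0]; first by rewrite n0.
have D0 x y : D x%:Z y%:Z = 0.
  elim: x => [|x IH]; last by rewrite -intSD Dr.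
  elim: y => [|y IH]; last by rewrite -intSD Du.
  by have [] := cell0 (fun k => F_left k n0).
have U0 x y : U x%:Z y%:Z = 0.
  by have /esym := eigen_a x%:Z y%:Z; rewrite mu0 mul0r D0 addr0.
have cb x y : (x < n)%N -> (y < n)%N -> f x%:Z y%:Z Cc = - f x%:Z y%:Z Cb.
  move=> xn yn; have := U0 x y; rewrite /U F_a// add0r => /eqP.
  by rewrite addrC addr_eq0 => /eqP.
(* [D0] at (x + 1, y + 1) together with [cb] makes the value at [Cb] constant along antidiagonals,
   each of which ends in the bottom row or the last column. *)
have b0 y : (y < n)%N -> forall x, (x < n)%N -> f x%:Z y%:Z Cb = 0.
  elim: y => [|y IH] yn x xn; first exact: F_bottom.
  have [xn1|xn1] := eqVneq x n.-1; first by rewrite xn1; exact: F_right.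
  have xn2 : (x.+1 < n)%N by lia.
  have := D0 x.+1 y.+1; rewrite /D F_a// !intSB cb//; last exact: ltnW.
  by rewrite add0r IH//; [rewrite oppr0 addr0|exact: ltnW].
move=> x y [] xn yn; [exact: F_a|exact: b0|by rewrite cb// b0// oppr0].
Qed.

End Determination.
End KagomeModel.

(** Comparisons of the area of a box with the length of its boundary end here; the contradicting
    size is N + 1 with N > (k + b + 1) / a. *)
Lemma quadratic_le_linear (R : realType) (a : R) (b k : nat) :
  (forall n, n%:R ^+ 2 * a <= (k * n + b)%:R) -> a <= 0.
Proof.
move=> h; rewrite leNgt; apply/negP => a0.
have N1 := archi_boundP (ltW (divr_gt0 (ltr0Sn R (k + b)) a0)).
set N := Num.bound _ in N1.
have := h N.+1.
apply/negP; rewrite -ltNge.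
apply: (@lt_le_trans _ _ ((k + b).+1%:R * N.+1%:R)).
  by rewrite -natrM ltr_nat; nia.
rewrite expr2 -mulrA [leRHS]mulrC ler_wpM2r// -ler_pdivrMr//.
by rewrite (le_trans (ltW N1))// ler_nat.
Qed.

(** * The mass of an energy per cell *)

Section EigenMass.
Context {R : realType} {T : choiceType}.
Context (iota : cell_site -> T) (kappa : T -> cell_site).
Context (ik : cancel iota kappa) (ki : cancel kappa iota).
Implicit Types F G : T -> R[i].
Local Notation A := (@tri_lap R T (tup iota kappa) (tdn iota kappa)).
Context {P : set R -> (T -> R[i]) -> T -> R[i]} (spec : is_spectral_measure A P).
Let pvmP : is_bounded_pvm P := spec.1.
Let opA : is_pos_op A := kagome_op ik ki.
Local Notation mass := (@eigen_mass R T iota P).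

(** Left column, right column and bottom row, the data of the upward recursion. Overlaps are counted
    repeatedly, so that there are exactly 9 n indices. *)
Let boundary n (j : 'I_3 * 'I_n * corner) : T :=
  iota (match val j.1.1 with
        | 0 => (0, j.1.2%:Z) | 1 => (n.-1%:Z, j.1.2%:Z) | _ => (j.1.2%:Z, 0)
        end, j.2).

Let boundary0 n F : (forall j, F (@boundary n j) = 0) ->
  [/\ forall i k, (i < n)%N -> F (iota (0, i%:Z, k)) = 0,
      forall i k, (i < n)%N -> F (iota (n.-1%:Z, i%:Z, k)) = 0
    & forall i k, (i < n)%N -> F (iota (i%:Z, 0, k)) = 0].
Proof.
move=> h; split=> i k ilt.
- exact: (h (@Ordinal 3 0 isT, Ordinal ilt, k)).
- exact: (h (@Ordinal 3 1 isT, Ordinal ilt, k)).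
- exact: (h (@Ordinal 3 2 isT, Ordinal ilt, k)).
Qed.

Let card_boundary n : #|{: 'I_3 * 'I_n * corner}| = (9 * n)%N.
Proof. by rewrite !card_prod !card_ord card_corner; lia. Qed.

Lemma eigen_mass_ge0 c k :
  0 <= rip (delta (iota (0, 0, k))) (P [set c] (delta (iota (0, 0, k)))).
Proof. by apply: (rip_pvm_ge0 pvmP); [exact: measurable_set1|exact: ell2_delta]. Qed.

Lemma eigen_mass_eq0 c : c != 3 / 2 -> mass c = 0.
Proof.
move=> c32; apply/eqP; rewrite eq_le; apply/andP; split; last first.
  by apply: sumr_ge0 => k _; exact: eigen_mass_ge0.
apply: (@quadratic_le_linear R _ 0 9) => n; rewrite addn0 -(box_trace ik ki spec).
rewrite -card_boundary.
apply: (eigen_trace_le opA spec (@box_pt_inj _ _ _ ik n) (s := @boundary n)).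
move=> F hF eigF /boundary0[Fl Fr Fb] [[x y] k]; rewrite /box_pt /=.
exact: (eigen_determined ik eigF Fl Fr Fb c32).
Qed.

Lemma eigen_mass_flat_le : mass (3 / 2) <= 1.
Proof.
rewrite -subr_le0; apply: (@quadratic_le_linear R _ 0 9) => n.
rewrite mulrBr mulr1 addn0 lerBlDl -(box_trace ik ki spec).
pose s (j : 'I_n * 'I_n + 'I_3 * 'I_n * corner) : T :=
  match j with
  | inl i => iota (i.1%:Z, i.2%:Z, Ca) | inr j' => boundary j'
  end.
have -> : n%:R ^+ 2 + (9 * n)%:R = #|{: 'I_n * 'I_n + 'I_3 * 'I_n * corner}|%:R :> R.
  by rewrite card_sum card_boundary card_prod !card_ord natrD !natrM expr2.
apply: (eigen_trace_le opA spec (@box_pt_inj _ _ _ ik n) (s := s)).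
move=> F hF eigF Fs [[x y] k]; rewrite /box_pt /=.
have [Fl Fr Fb] := boundary0 (fun j => Fs (inr j)).
apply: (flat_band_determined ik eigF Fl Fr Fb) => // x' y' xn yn.
exact: (Fs (inl (Ordinal xn, Ordinal yn))).
Qed.

(** The constraints come from the n^2 up-triangles of the box and the down-triangles with [Ca] in an
    (n + 1) x (n + 1) box, among them all those meeting the box; 3 n^2 - n^2 - (n + 1)^2 = n^2 - (2
    n + 1). A combination obeying them has zero sum over every triangle of the lattice, hence energy
    3/2. *)
Lemma eigen_mass_flat_ge : 1 <= mass (3 / 2).
Proof.
rewrite -subr_le0; apply: (@quadratic_le_linear R _ 1 2) => n.
rewrite mulrBr mulr1 lerBlDr -(box_trace ik ki spec).
pose f (t : T) (j : 'I_n * 'I_n + 'I_n.+1 * 'I_n.+1) : R[i] :=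
  match j with
  | inl i => let v := iota (i.1%:Z, i.2%:Z, Ca) in
      delta t v + delta t (tup iota kappa v) + delta t (tup iota kappa (tup iota kappa v))
  | inr i => let v := iota (i.1%:Z, i.2%:Z, Ca) in
      delta t v + delta t (tdn iota kappa v) + delta t (tdn iota kappa (tdn iota kappa v))
  end.
have : #|{: 'I_n * 'I_n * corner}|%:R - #|{: 'I_n * 'I_n + 'I_n.+1 * 'I_n.+1}|%:R <=
    \sum_(i : 'I_n * 'I_n * corner)
      rip (delta (box_pt iota i)) (P [set 3 / 2] (delta (box_pt iota i))).
  apply: (eigen_trace_ge opA spec (@box_pt_inj _ _ _ ik n) (f := f)) => x xf.
  set F := fin_comb _ x.
  have in0 (j : 'I_n * 'I_n + 'I_n.+1 * 'I_n.+1) (a b e : T) :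
      (forall t, f t j = delta t a + delta t b + delta t e) -> F a + F b + F e = 0.
    move=> fj; rewrite -(xf j) /F /fin_comb -!big_split /=.
    by apply: eq_bigr => i _; rewrite fj !mulrDr.
  have out0 (a b : int) k : ~~ [&& 0 <= a, a < n%:Z, 0 <= b & b < n%:Z] ->
      F (iota (a, b, k)) = 0.
    move=> h; apply: fin_comb_out => -[[i j] k'] /(can_inj ik) [ai bj _].
    move: h; rewrite ai bj; have := ltn_ord i; have := ltn_ord j; lia.
  have U0 a b : F (iota (a, b, Ca)) + F (iota (a, b, Cb)) + F (iota (a, b, Cc)) = 0.
    have [/and4P[]|h] := boolP [&& 0 <= a, a < n%:Z, 0 <= b & b < n%:Z]; last first.
      by rewrite !out0 ?addr0.
    case: a => // a; case: b => // b _ an _ bn.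
    have an' : (a < n)%N by []; have bn' : (b < n)%N by [].
    apply: (in0 (inl (Ordinal an', Ordinal bn'))) => t.
    by rewrite /f !tup_iota.
  have dn2 a b : dn (dn (a, b, Ca)) = (a, b - 1, Cc) by rewrite /= subrK.
  have D0 a b : F (iota (a, b, Ca)) + F (iota (a - 1, b, Cb)) + F (iota (a, b - 1, Cc)) = 0.
    (* The down-triangle at (a, b) also meets the cells (a - 1, b) and (a, b - 1), which is why [a]
       and [b] range up to [n] included. *)
    have [/and4P[]|h] := boolP [&& 0 <= a, a < n.+1%:Z, 0 <= b & b < n.+1%:Z]; last first.
      by rewrite !out0 ?addr0//; lia.
    case: a => // a; case: b => // b _ an _ bn.
    have an' : (a < n.+1)%N by []; have bn' : (b < n.+1)%N by [].
    apply: (in0 (inr (Ordinal an', Ordinal bn'))) => t.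
    by rewrite /f !(tdn_iota ik) dn2.
  have UT t : F t + F (tup iota kappa t) + F (tup iota kappa (tup iota kappa t)) = 0.
    rewrite -(ki t) !(tup_iota ik); case: (kappa t) => -[a b] []; rewrite -[RHS](U0 a b) /=; ring.
  have DT t : F t + F (tdn iota kappa t) + F (tdn iota kappa (tdn iota kappa t)) = 0.
    rewrite -(ki t) !(tdn_iota ik); case: (kappa t) => -[a b] [] /=.
    - by rewrite -[RHS](D0 a b) subrK.
    - by rewrite -[RHS](D0 (a + 1) b) ?subrK ?addrK; ring.
    - by rewrite -[RHS](D0 a (b + 1)) ?subrK ?addrK; ring.
  by rewrite tri_lapE; apply/funext => t; rewrite UT DT addr0 mulr0 addr0.
rewrite card_sum !card_prod !card_ord card_corner => h.
rewrite -lerBlDl; apply: le_trans h; rewrite le_eqVlt; apply/orP; left; apply/eqP; ring.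
Qed.

End EigenMass.

(** * Truncated plane waves *)

Section PlaneWave.
Context {R : realType} {T : choiceType}.
Context (iota : cell_site -> T) (kappa : T -> cell_site).
Context (ik : cancel iota kappa) (ki : cancel kappa iota).
Local Notation A := (@tri_lap R T (tup iota kappa) (tdn iota kappa)).

(** A linear function of the position, with value 1 at [w1] and -1 at [w2]. On this line of
    quasi-momenta the Bloch matrix is real and invariant under the exchange of [Cb] and [Cc]. *)
Let phase (v : cell_site) : int :=
  let: (a, b, k) := v in
  2 * (a - b) + match k with Ca => 0 | Cb => 1 | Cc => -1 end.

Let wave (s : R[i]) (al : corner -> R) (t : T) : R[i] :=
  (al (kappa t).2)%:C%C * s ^ phase (kappa t).

(** For s = exp (i t) and g = cos t the three equations are the eigenvalue problem of the Bloch
    matrix, with 2 g^2 - 1 = cos 2t. The relations s^-1 = 2 g - s and s^2 = 2 g s - 1 reduce all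
    powers of [s] to the span of 1 and [s]. *)
Let wave_eigen (g : R) (s : R[i]) (al : corner -> R) (c : R) :
  s != 0 -> s^-1 = 2 * g%:C%C - s ->
  (2 * (1 - c) * al Ca = g * (al Cb + al Cc)) ->
  (2 * (1 - c) * al Cb = g * al Ca + (2 * g ^+ 2 - 1) * al Cc) ->
  (2 * (1 - c) * al Cc = g * al Ca + (2 * g ^+ 2 - 1) * al Cb) ->
  A (wave s al) = fun t => c%:C%C * wave s al t.
Proof.
move=> s0 sV ha hb hc.
set G := g%:C%C in sV.
have ss : s * s = 2 * G * s - 1.
  by have := mulfV s0; rewrite sV mulrBr => /eqP; rewrite subr_eq => /eqP e; rewrite [2 * G * s]mulrC e addrAC subrr add0r.
have E0 (M : int) : s ^ (M + 0) = s ^ M by rewrite addr0.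
have E1 (M : int) : s ^ (M + 1) = s ^ M * s by rewrite expfzDr// expr1z.
have E2 (M : int) : s ^ (M + 2) = s ^ M * (2 * G * s - 1).
  by rewrite expfzDr// -ss.
have E3 (M : int) : s ^ (M + 3) = s ^ M * ((4 * G ^+ 2 - 1) * s - 2 * G).
  rewrite expfzDr//; congr (_ * _).
  have -> : s ^ 3 = s * s * s by rewrite -[3]/(Posz 3) -exprnP !exprS expr0 mulr1 mulrA.
  have -> : s * s * s = (2 * G * s - 1) * s by rewrite ss.
  have -> : (2 * G * s - 1) * s = 2 * G * (s * s) - s by ring.
  by rewrite ss; ring.
have N1 (M : int) : s ^ (M - 1) = s ^ M * (2 * G - s) by rewrite expfzDr// exprN1 sV.
have N2 (M : int) : s ^ (M - 2) = s ^ M * (4 * G ^+ 2 - 1 - 2 * G * s).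
  rewrite (_ : M - 2 = M - 1 - 1); last by ring.
  rewrite !N1 -mulrA; congr (_ * _).
  have -> : (2 * G - s) * (2 * G - s) = 4 * G ^+ 2 - 4 * G * s + s * s by ring.
  by rewrite ss; ring.
have N3 (M : int) : s ^ (M - 3) = s ^ M * ((4 * G ^+ 2 - 1) * (2 * G - s) - 2 * G).
  rewrite (_ : M - 3 = M - 2 - 1); last by ring.
  rewrite N1 N2 -mulrA; congr (_ * _).
  have -> : (4 * G ^+ 2 - 1 - 2 * G * s) * (2 * G - s) =
    (4 * G ^+ 2 - 1) * (2 * G - s) - 4 * G ^+ 2 * s + 2 * G * (s * s) by ring.
  by rewrite ss; ring.
pose a := (al Ca)%:C%C; pose b := (al Cb)%:C%C; pose e := (al Cc)%:C%C.
pose c' := c%:C%C : R[i].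
have n2 : (2 : R)%:C%C = 2 :> R[i] by rewrite rmorph_nat.
have ha' : 2 * (1 - c') * a = G * (b + e).
  by apply/eqP; rewrite -n2 eq_complex /=; apply/andP; split; apply/eqP; lra.
have hb' : 2 * (1 - c') * b = G * a + (2 * G ^+ 2 - 1) * e.
  by apply/eqP; rewrite -n2 eq_complex /=; apply/andP; split; apply/eqP; lra.
have hc' : 2 * (1 - c') * e = G * a + (2 * G ^+ 2 - 1) * b.
  by apply/eqP; rewrite -n2 eq_complex /=; apply/andP; split; apply/eqP; lra.
have waveE x y k M j : phase (x, y, k) = M + j ->
    wave s al (iota (x, y, k)) = (al k)%:C%C * s ^ (M + j).
  by move=> <-; rewrite /wave ik.
apply/funext => t; rewrite /tri_lap -(ki t); case: (kappa t) => -[x y] k.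
rewrite !(tup_iota ik) !(tdn_iota ik).
pose M := 2 * (x - y).
case: k.
- have -> : dn (dn (x, y, Ca)) = (x, y - 1, Cc) by rewrite /= subrK.
  rewrite /up /dn (waveE x y Ca M 0) ?(waveE x y Cb M 1) ?(waveE x y Cc M (-1))//.
  rewrite (waveE (x - 1) y Cb M (-1)) ?(waveE x (y - 1) Cc M 1); last 2 first.
  + by rewrite /phase /M; ring.
  + by rewrite /phase /M; ring.
  rewrite E0 E1 N1 -/a -/b -/e -/c'.
  have -> : a * s ^ M - 4^-1 * (b * (s ^ M * s) + e * (s ^ M * (2 * G - s)) +
     b * (s ^ M * (2 * G - s)) + e * (s ^ M * s)) =
     s ^ M * (a - 2^-1 * (G * (b + e))) by field.
  by rewrite -ha'; field.
- have -> : dn (dn (x, y, Cb)) = (x + 1, y, Ca) by rewrite /= subrK.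
  rewrite /up /dn (waveE x y Ca M 0) ?(waveE x y Cb M 1) ?(waveE x y Cc M (-1))//.
  rewrite (waveE (x + 1) y Ca M 2) ?(waveE (x + 1) (y - 1) Cc M 3); last 2 first.
  + by rewrite /phase /M; ring.
  + by rewrite /phase /M; ring.
  rewrite E0 E1 E2 E3 N1 -/a -/b -/e -/c'.
  have -> : b * (s ^ M * s) - 4^-1 * (e * (s ^ M * (2 * G - s)) + a * s ^ M +
     e * (s ^ M * ((4 * G ^+ 2 - 1) * s - 2 * G)) + a * (s ^ M * (2 * G * s - 1))) =
     s ^ M * s * (b - 2^-1 * (G * a + (2 * G ^+ 2 - 1) * e)) by field.
  by rewrite -hb'; field.
- have -> : dn (dn (x, y, Cc)) = (x - 1, y + 1, Cb) by [].
  rewrite /up /dn (waveE x y Ca M 0) ?(waveE x y Cb M 1) ?(waveE x y Cc M (-1))//.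
  rewrite (waveE x (y + 1) Ca M (- 2)) ?(waveE (x - 1) (y + 1) Cb M (- 3)); last 2 first.
  + by rewrite /phase /M; ring.
  + by rewrite /phase /M; ring.
  rewrite E0 E1 N1 N2 N3 -/a -/b -/e -/c'.
  have -> : e * (s ^ M * (2 * G - s)) - 4^-1 * (a * s ^ M + b * (s ^ M * s) +
     a * (s ^ M * (4 * G ^+ 2 - 1 - 2 * G * s)) +
     b * (s ^ M * ((4 * G ^+ 2 - 1) * (2 * G - s) - 2 * G))) =
     s ^ M * (2 * G - s) * (e - 2^-1 * (G * a + (2 * G ^+ 2 - 1) * b)) by field.
  by rewrite -hc'; field.
Qed.

Let nrm2 (z : R[i]) : R := complex.Re (z * z^*%C).

(** Two bands serve: energy 1 - g^2 with amplitudes (1, g, g) for c <= 1, and energy 1/2 + g^2 with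
    the antisymmetric amplitudes (0, 1, -1) for c > 1. Modulus one at a whole class [k] of corners
    makes the squared norm on a box at least its number of cells. *)
Lemma plane_wave (c : R) : 0 < c -> c < 3 / 2 ->
  exists psi : T -> R[i], [/\ A psi = (fun t => c%:C%C * psi t),
    forall t, nrm2 (psi t) <= 1
    & exists k, forall a b, nrm2 (psi (iota (a, b, k))) = 1].
Proof.
move=> c0 c32.
have [g [g0 g1 [al [al1 [k alk]] [ha hb hc]]]] : exists g : R, [/\ 0 <= g, g <= 1 &
  exists2 al : corner -> R, (forall k, al k ^+ 2 <= 1) /\ (exists k, al k ^+ 2 = 1) &
  [/\ 2 * (1 - c) * al Ca = g * (al Cb + al Cc),
  2 * (1 - c) * al Cb = g * al Ca + (2 * g ^+ 2 - 1) * al Cc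
  & 2 * (1 - c) * al Cc = g * al Ca + (2 * g ^+ 2 - 1) * al Cb]].
  have [c1|c1] := leP c 1.
    have c10 : 0 <= 1 - c by rewrite subr_ge0.
    exists (Num.sqrt (1 - c)); set g := Num.sqrt _.
    have g2 : g ^+ 2 = 1 - c by rewrite sqr_sqrtr.
    have g0 : 0 <= g by exact: sqrtr_ge0.
    have g1 : g <= 1 by rewrite -(@ler_pXn2r _ 2)// ?nnegrE// expr1n g2 gerBl ltW.
    split=> //; exists (fun k => if k is Ca then 1 else g).
      split; last by exists Ca; rewrite expr1n.
      by case; rewrite ?expr1n// g2 gerBl ltW.
    by rewrite -g2; split; ring.
  have c10 : 0 <= c - 1 / 2 by lra.
  exists (Num.sqrt (c - 1 / 2)); set g := Num.sqrt _.
  have g2 : g ^+ 2 = c - 1 / 2 by rewrite sqr_sqrtr.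
  have g0 : 0 <= g by exact: sqrtr_ge0.
  have g1 : g <= 1 by rewrite -(@ler_pXn2r _ 2)// ?nnegrE// expr1n g2; lra.
  split=> //; exists (fun k => match k with Ca => 0 | Cb => 1 | Cc => -1 end).
    split; last by exists Cb; rewrite expr1n.
    by case; rewrite ?expr1n ?expr0n ?sqrrN ?expr1n.
  by rewrite g2; split; field.
pose s : R[i] := (g +i* Num.sqrt (1 - g ^+ 2))%C.
have g21 : 0 <= 1 - g ^+ 2 by rewrite subr_ge0 expr_le1.
have sc : s * s^*%C = 1.
  have -> : 1 = (1 +i* 0)%C :> R[i] by [].
  rewrite /s /=; congr (_ +i* _)%C; last by ring.
  by rewrite mulrN opprK -!expr2 sqr_sqrtr//; ring.
have s0 : s != 0 by apply: contra_eq_neq sc => ->; rewrite mul0r eq_sym oner_neq0.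
have sV : s^-1 = 2 * g%:C%C - s.
  apply: (mulfI s0); rewrite mulfV//; apply: etrans (esym sc) _; congr (_ * _).
  have -> : 2 = (2 +i* 0)%C :> R[i] by exact: (esym (rmorph_nat (real_complex R) 2)).
  by rewrite /s /=; congr (_ +i* _)%C; ring.
have normz (m : int) : nrm2 (s ^ m) = 1.
  suff e : s ^ m * (s ^ m)^*%C = 1 by rewrite /nrm2 e.
  have -> : (s ^ m)^*%C = (s^*%C) ^ m by exact: (rmorphXz (@conjc R)).
  by rewrite -expfzMl sc exp1rz.
have nrmw t : nrm2 (wave s al t) = al (kappa t).2 ^+ 2.
  rewrite /wave; have := normz (phase (kappa t)); rewrite /nrm2.
  case: (s ^ _) => p q /=; set r := al _ => h.
  by rewrite -[RHS]mulr1 -h; ring.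
exists (wave s al); split.
- exact: (wave_eigen s0 sV ha hb hc).
- by move=> t; rewrite nrmw.
- by exists k => a b; rewrite nrmw ik.
Qed.

End PlaneWave.

Section RipMore.
Context {R : realType} {T : choiceType}.
Implicit Types F G : T -> R[i].
Local Notation Re := complex.Re.

Lemma rip_le F G : (forall t, Re (F t * (F t)^*%C) <= Re (G t * (G t)^*%C)) ->
  ell2 G -> rip F F <= rip G G.
Proof.
move=> FG hG.
have nE (z : R[i]) : Re (z * z^*%C) = Re (`|z| ^+ 2) by rewrite sqr_normc.
have FG' : (sqnorm F <= sqnorm G)%E.
  by apply: le_esum => t _; rewrite lee_fin -!nE.
have hF : ell2 F by exact: le_lt_trans hG.
by rewrite -lee_fin -!sqnorm_rip.
Qed.

Lemma rip_add_le F G : ell2 F -> ell2 G ->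
  rip (fun t => F t + G t) (fun t => F t + G t) <= 2 * (rip F F + rip G G).
Proof.
move=> hF hG; have hS := ell2_add hF hG; have hB := ell2_sub hF hG.
have := rip_ge0 (fun t => F t - G t).
rewrite (ripBr hB hF hG) (ripBl hF hF hG) (ripBl hG hF hG).
rewrite (ripDr hS hF hG) (ripDl hF hF hG) (ripDl hG hF hG).
rewrite [rip G F]ripC; lra.
Qed.

End RipMore.

(** * Strict monotonicity by truncation of waves *)

Section Strictness.
Context {R : realType} {T : choiceType}.
Context (iota : cell_site -> T) (kappa : T -> cell_site).
Context (ik : cancel iota kappa) (ki : cancel kappa iota).
Implicit Types F G : T -> R[i].
Local Notation Re := complex.Re.
Local Notation tu := (tup iota kappa).
Local Notation td := (tdn iota kappa).
Local Notation A := (@tri_lap R T tu td).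
Let nrm2 (z : R[i]) : R := Re (z * z^*%C).

Section Truncation.
Variable n : nat.
Local Notation pt := (@box_pt T iota n).
Let pt_inj : injective pt := @box_pt_inj T iota kappa ik n.
Let chi : T -> R[i] := fin_comb pt (fun=> 1).

Let chi_ell2 : ell2 chi. Proof. exact: fin_comb_ell2. Qed.

Let chi_in (a b : int) k : 0 <= a -> a < n%:Z -> 0 <= b -> b < n%:Z ->
  chi (iota (a, b, k)) = 1.
Proof.
case: a => // a; case: b => // b _ an _ bn.
have an' : (a < n)%N by []; have bn' : (b < n)%N by [].
exact: (fin_combE pt_inj (fun=> 1) (Ordinal an', Ordinal bn', k)).
Qed.

Let chi_ge0 t : 0 <= Re (chi t).
Proof.
rewrite /chi /fin_comb Re_sum; apply: sumr_ge0 => i _.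
by rewrite mul1r deltaE; case: eqP.
Qed.

(** Counts the sides of the box on which a cell lies; cells with value 0 have all their neighbours
    inside. The constant 12 below is four sides times three corners. *)
Let border (i : 'I_n * 'I_n * corner) : nat :=
  ((i.1.1 == 0 :> nat) + (i.1.1 == n.-1 :> nat) +
  ((i.1.2 == 0 :> nat) + (i.1.2 == n.-1 :> nat)))%N.

Let sum_border : \sum_i (border i)%:R <= (12 * n)%:R :> R.
Proof.
have one (a : nat) : \sum_(x < n) (x == a :> nat)%:R <= 1 :> R.
  have [an|an] := ltnP a n.
    rewrite (bigD1 (Ordinal an))//= eqxx big1 ?addr0// => x.
    by rewrite -val_eqE /= => /negbTE ->.
  by rewrite big1 ?ler01// => x _; rewrite (ltn_eqF (leq_trans (ltn_ord x) an)).
have sum1 (f : 'I_n -> R) : \sum_(i : 'I_n * 'I_n * corner) f i.1.1 =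
    (3 * n)%:R * \sum_x f x.
  rewrite -(pair_bigA _ (fun (p : 'I_n * 'I_n) (k : corner) => f p.1))/=.
  under eq_bigr do rewrite sumr_const card_corner -[f _ *+ 3]mulr_natl.
  rewrite -mulr_sumr -(pair_bigA _ (fun (x y : 'I_n) => f x))/=.
  under eq_bigr do rewrite sumr_const card_ord -[f _ *+ n]mulr_natl.
  by rewrite -mulr_sumr mulrA natrM.
have sum2 (f : 'I_n -> R) : \sum_(i : 'I_n * 'I_n * corner) f i.1.2 =
    (3 * n)%:R * \sum_x f x.
  rewrite -(pair_bigA _ (fun (p : 'I_n * 'I_n) (k : corner) => f p.2))/=.
  under eq_bigr do rewrite sumr_const card_corner -[f _ *+ 3]mulr_natl.
  rewrite -mulr_sumr -(pair_bigA _ (fun (x y : 'I_n) => f y))/=.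
  by rewrite sumr_const card_ord -[X in _ * X]mulr_natl mulrA natrM.
under eq_bigr do rewrite /border !natrD.
rewrite !big_split /= (sum1 (fun x => (x == 0 :> nat)%:R)).
rewrite (sum1 (fun x => (x == n.-1 :> nat)%:R)).
rewrite (sum2 (fun x => (x == 0 :> nat)%:R)) (sum2 (fun x => (x == n.-1 :> nat)%:R)).
rewrite -!mulrDr (_ : (12 * n)%:R = (3 * n)%:R * 4%:R); last by rewrite -natrM; congr (_%:R); lia.
rewrite ler_wpM2l//; have := one 0%N; have := one n.-1; lra.
Qed.

(** The squared norm is 2 |chi|^2 - 2 (chi, chi o s), twice the number of points of the box that [s]
    moves out of it, and such points have a nonzero [border]. *)
Let variation (s s' : T -> T) : cancel s s' -> cancel s' s ->
  (forall i, border i = 0%N -> chi (s (pt i)) = 1) ->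
  rip (fun t => chi (s t) - chi t) (fun t => chi (s t) - chi t) <= (24 * n)%:R.
Proof.
move=> ss' s's h; have bs : bijective s by exists s'.
have hs := ell2_comp bs chi_ell2.
have hB := ell2_sub hs chi_ell2.
rewrite (ripBr hB hs chi_ell2) (ripBl hs hs chi_ell2) (ripBl chi_ell2 hs chi_ell2).
rewrite (rip_comp _ _ bs) [rip (fun t => chi (s t)) chi]ripC.
have -> : rip chi chi = \sum_(i : 'I_n * 'I_n * corner) 1.
  rewrite (rip_fin_comb_self pt_inj); apply: eq_bigr => i _.
  by rewrite mul1r conjc1.
have -> : rip chi (fun t => chi (s t)) = \sum_i Re (chi (s (pt i))).
  rewrite rip_fin_comb//; apply: eq_bigr => i _.
  by rewrite conjc1 mulr1.
have le : \sum_i (1 - Re (chi (s (pt i)))) <= (12 * n)%:R :> R.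
  apply: le_trans sum_border; apply: ler_sum => i _.
  case b0 : (border i) => [|b]; first by rewrite h// subrr.
  by rewrite (@le_trans _ _ 1) ?ler1n// gerBl.
move: le; rewrite sumrB !natrM; lra.
Qed.

Variables (c : R) (psi : T -> R[i]).
Hypotheses (psi_eig : A psi = fun t => c%:C%C * psi t)
  (psi1 : forall t, nrm2 (psi t) <= 1).

Let F := fin_comb pt (fun i => psi (pt i)).

Let FE t : F t = chi t * psi t.
Proof.
rewrite /F /chi /fin_comb mulr_suml; apply: eq_bigr => i _.
rewrite mul1r deltaE; case: eqP => [->|_]; first by rewrite mulrC.
by rewrite mulr0 mul0r.
Qed.

Let G (s : T -> T) t := (chi (s t) - chi t) * psi (s t).

Let nrm2M (z w : R[i]) : nrm2 (z * w) = nrm2 z * nrm2 w.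
Proof. by case: z w => [a b] [e f]; rewrite /nrm2 /=; ring. Qed.

Let nrm2_ge0 z : 0 <= nrm2 z.
Proof. by case: z => [a b]; rewrite /nrm2 /= mulrN opprK addr_ge0// -expr2 sqr_ge0. Qed.

Let G_le (s s' : T -> T) : cancel s s' -> cancel s' s ->
  (forall i, border i = 0%N -> chi (s (pt i)) = 1) ->
  ell2 (G s) /\ rip (G s) (G s) <= (24 * n)%:R.
Proof.
move=> ss' s's h; have bs : bijective s by exists s'.
have hB := ell2_sub (ell2_comp bs chi_ell2) chi_ell2.
have le t : nrm2 (G s t) <= nrm2 (chi (s t) - chi t).
  by rewrite /G nrm2M ler_piMr.
split; last by apply: le_trans (variation ss' s's h); exact: rip_le.
apply: le_lt_trans hB; apply: le_esum => t _; rewrite lee_fin.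
by rewrite !sqr_normc; exact: le.
Qed.

(* On chi psi the operator A - c acts through the differences of chi only. *)
Lemma truncated_wave :
  rip (fun t => A F t - c%:C%C * F t) (fun t => A F t - c%:C%C * F t) <= (24 * n)%:R.
Proof.
have u3 := @tup3 T iota kappa ik ki; have d3 := @tdn3 T iota kappa ik ki.
have border0 i : border i = 0%N ->
    [/\ 1 <= i.1.1%:Z, i.1.1%:Z + 1 < n%:Z, 1 <= i.1.2%:Z & i.1.2%:Z + 1 < n%:Z].
  case: i => [[x y] k] /=; rewrite /border /=.
  have := ltn_ord x; have := ltn_ord y; do 4 case: eqP => //.
  by move=> *; split; lia.
have [hu gu] : ell2 (G tu) /\ rip (G tu) (G tu) <= (24 * n)%:R.
  apply: (@G_le _ (tu \o tu)) => [t|t|i /border0]; [exact: u3|exact: u3|].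
  by rewrite /pt (tup_iota ik); case: i => [[x y] []] /= [? ? ? ?]; apply: chi_in; lia.
have [hd gd] : ell2 (G td) /\ rip (G td) (G td) <= (24 * n)%:R.
  apply: (@G_le _ (td \o td)) => [t|t|i /border0]; [exact: d3|exact: d3|].
  by rewrite /pt (tdn_iota ik); case: i => [[x y] []] /= [? ? ? ?]; apply: chi_in; lia.
have [huu guu] : ell2 (G (tu \o tu)) /\ rip (G (tu \o tu)) (G (tu \o tu)) <= (24 * n)%:R.
  apply: (@G_le _ tu) => [t|t|i /border0]; [exact: u3|exact: u3|].
  by rewrite /= /pt !(tup_iota ik); case: i => [[x y] []] /= [? ? ? ?]; apply: chi_in; lia.
have [hdd gdd] : ell2 (G (td \o td)) /\ rip (G (td \o td)) (G (td \o td)) <= (24 * n)%:R.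
  apply: (@G_le _ td) => [t|t|i /border0]; [exact: d3|exact: d3|].
  by rewrite /= /pt !(tdn_iota ik); case: i => [[x y] []] /= [? ? ? ?]; apply: chi_in; lia.
pose S1 t := G tu t + G (tu \o tu) t; pose S2 t := G td t + G (td \o td) t.
have h1 : ell2 S1 by exact: ell2_add.
have h2 : ell2 S2 by exact: ell2_add.
have hS := ell2_add h1 h2.
have -> : (fun t => A F t - c%:C%C * F t) = fun t => (- 4^-1)%:C%C * (S1 t + S2 t).
  apply/funext => t; rewrite /tri_lap !FE.
  have := congr1 (@^~ t) psi_eig; rewrite /tri_lap => e.
  have -> : c%:C%C * (chi t * psi t) = chi t * (c%:C%C * psi t) by ring.
  rewrite -e /S1 /S2 /G /=.
  have -> : (- 4^-1)%:C%C = - 4^-1 :> R[i] by rewrite rmorphN fmorphV rmorph_nat.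
  by field.
have hSS : ell2 (fun t => (- 4^-1)%:C%C * (S1 t + S2 t)) by exact: ell2_scale.
rewrite (ripZr _ hSS hS) (ripZl _ hS hS).
(* Four terms of squared norm at most 24 n: their sum has squared norm at most 16 times that, and
   the factor (1/4)^2 cancels the 16. *)
have l1 := rip_add_le hu huu; have l2 := rip_add_le hd hdd.
have l3 := rip_add_le h1 h2.
rewrite -/S1 in l1; rewrite -/S2 in l2.
lra.
Qed.

Lemma truncated_wave_norm k : (forall a b, nrm2 (psi (iota (a, b, k))) = 1) ->
  n%:R ^+ 2 <= rip F F.
Proof.
move=> psik; rewrite (rip_fin_comb_self pt_inj).
have -> : n%:R ^+ 2 = \sum_(i : 'I_n * 'I_n * corner) (i.2 == k)%:R :> R.
  rewrite (sum_box (fun k' => (k' == k)%:R)) (bigD1 k)//= eqxx big1 ?addr0 ?mulr1//.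
  by move=> k' /negbTE ->.
apply: ler_sum => -[[x y] k'] _; rewrite -/(nrm2 _) /=.
by case: eqP => [->|_]; [rewrite /box_pt /= psik|].
Qed.

End Truncation.

Context {P : set R -> (T -> R[i]) -> T -> R[i]} (spec : is_spectral_measure A P).
Let pvmP : is_bounded_pvm P := spec.1.
Let opA : is_pos_op A := kagome_op ik ki.
Local Notation cdf := (@spectral_cdf R T P).

Lemma spectral_cdf_strict x y : 0 <= x -> x < y -> y <= 3 / 2 ->
  exists k, cdf (delta (iota (0, 0, k))) x < cdf (delta (iota (0, 0, k))) y.
Proof.
move=> x0 xy y32; apply: contrapT => /forallNP h.
have mxy : measurable `]x, y]%classic by exact: measurable_itv.
have mx : measurable `]-oo, x]%classic by exact: measurable_itv.
have gap v : P `]x, y]%classic (delta (iota v)) = fun=> 0.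
  case: v => [[a b] k]; set d := delta _.
  have hd : ell2 d by exact: ell2_delta.
  apply: rip_eq0; first exact: (pvm_ell2 pvmP).
  rewrite -(rip_pvm pvmP)//; apply/eqP; rewrite eq_le (rip_pvm_ge0 pvmP)// andbT.
  have yE : `]-oo, y]%classic = `]-oo, x]%classic `|` `]x, y]%classic.
    apply/seteqP; split=> z /=; rewrite !in_itv/=.
      by move=> zy; have [zx|xz] := leP z x; [left|right].
    by case=> [zx|/andP[]//]; exact: le_trans zx (ltW xy).
  have := h k; rewrite -!(kagome_cdf_shift ik ki spec a b) => /negP.
  rewrite -leNgt /spectral_cdf yE (rip_pvm_setU pvmP)// -?/d.
    by rewrite gerDl.
  by apply/seteqP; split=> z //=; rewrite !in_itv/= => -[zx /andP[]]; rewrite ltNge zx.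
have c0 : 0 < (x + y) / 2 by lra.
have c32 : (x + y) / 2 < 3 / 2 by lra.
have [psi [psi_eig psi1 [k psik]]] := @plane_wave R T iota kappa ik ki _ c0 c32.
have : ((y - x) / 2) ^+ 2 <= 0.
  apply: (@quadratic_le_linear R _ 0 24) => n; rewrite addn0.
  pose F := fin_comb (@box_pt T iota n) (fun i => psi (box_pt iota i)).
  have hF : ell2 F by exact: fin_comb_ell2.
  have PF : P `]x, y]%classic F = fun=> 0.
    rewrite (pvm_fin_comb spec)//; apply/funext => t.
    by rewrite big1// => i _; rewrite gap mulr0.
  apply: le_trans (truncated_wave n psi_eig psi1).
  apply: le_trans (spectral_gap opA spec xy hF PF).
  by rewrite mulrC ler_wpM2l ?sqr_ge0//; exact: truncated_wave_norm psik.
by apply/negP; rewrite -ltNge exprn_gt0// divr_gt0// subr_gt0.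
Qed.

End Strictness.

(** * The density of states per cell *)

Section DensityOfStates.
Context {R : realType} {T : choiceType}.
Context (iota : cell_site -> T) (kappa : T -> cell_site).
Context (ik : cancel iota kappa) (ki : cancel kappa iota).
Implicit Types F G : T -> R[i].
Local Notation tu := (tup iota kappa).
Local Notation td := (tdn iota kappa).
Local Notation A := (@tri_lap R T tu td).
Context {P : set R -> (T -> R[i]) -> T -> R[i]} (spec : is_spectral_measure A P).
Let pvmP : is_bounded_pvm P := spec.1.
Let opA : is_pos_op A := kagome_op ik ki.
Local Notation cdf := (@spectral_cdf R T P).
Local Notation mass := (@eigen_mass R T iota P).

Definition cell_dos (x : R) : R := 3^-1 * \sum_k cdf (delta (iota (0, 0, k))) x.

Let dk k : ell2 (delta (iota (0, 0, k)) : T -> R[i]).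
Proof. exact: ell2_delta. Qed.

Lemma cell_dos_mono x y : x <= y -> cell_dos x <= cell_dos y.
Proof.
move=> xy; rewrite ler_wpM2l// ler_sum// => k _.
exact: (spectral_cdf_mono spec (dk k) xy).
Qed.

Lemma cell_dos_jump_le a b : b < a -> cell_dos b + 3^-1 * mass a <= cell_dos a.
Proof.
move=> ba; rewrite -mulrDr ler_wpM2l// -big_split ler_sum// => k _.
exact: (spectral_cdf_jump_le spec (dk k) ba).
Qed.

Lemma cell_dos_right a e : 0 < e -> exists2 b, a < b & cell_dos b < cell_dos a + e.
Proof.
move=> e0.
have [ba aba la] := spectral_cdf_right spec (dk Ca) a e0.
have [bb abb lb] := spectral_cdf_right spec (dk Cb) a e0.
have [bc abc lc] := spectral_cdf_right spec (dk Cc) a e0.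
exists (Num.min ba (Num.min bb bc)); first by rewrite !lt_min aba abb abc.
set b := Num.min _ _.
have bba : b <= ba by rewrite ge_min lexx.
have bbb : b <= bb by rewrite !ge_min lexx orbT.
have bbc : b <= bc by rewrite !ge_min lexx !orbT.
have ma := spectral_cdf_mono spec (dk Ca) bba.
have mb := spectral_cdf_mono spec (dk Cb) bbb.
have mc := spectral_cdf_mono spec (dk Cc) bbc.
rewrite /cell_dos !sum_corner; lra.
Qed.

Lemma cell_dos_left a e : 0 < e ->
  exists2 b, b < a & cell_dos a - 3^-1 * mass a - e < cell_dos b.
Proof.
move=> e0.
have [ba aba la] := spectral_cdf_left spec (dk Ca) a e0.
have [bb abb lb] := spectral_cdf_left spec (dk Cb) a e0.
have [bc abc lc] := spectral_cdf_left spec (dk Cc) a e0.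
exists (Num.max ba (Num.max bb bc)); first by rewrite !gt_max aba abb abc.
set b := Num.max _ _.
have bba : ba <= b by rewrite le_max lexx.
have bbb : bb <= b by rewrite !le_max lexx orbT.
have bbc : bc <= b by rewrite !le_max lexx !orbT.
have ma := spectral_cdf_mono spec (dk Ca) bba.
have mb := spectral_cdf_mono spec (dk Cb) bbb.
have mc := spectral_cdf_mono spec (dk Cc) bbc.
rewrite /cell_dos /eigen_mass !sum_corner; lra.
Qed.

Lemma cell_dos_cvg_right (a : R) : cell_dos x @[x --> a^'+] --> cell_dos a.
Proof.
apply/cvgrPdist_lt => e /(cell_dos_right a)[b ab be].
near=> x.
have ax : a <= x by near: x; exact: nbhs_right_ge.
have xb : x <= b by near: x; exact: nbhs_right_le.
have := cell_dos_mono ax; have := cell_dos_mono xb => h1 h2.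
by rewrite ltr_norml; apply/andP; split; lra.
Unshelve. all: by end_near. Qed.

Lemma cell_dos_cvg_left (a : R) :
  cell_dos x @[x --> a^'-] --> cell_dos a - 3^-1 * mass a.
Proof.
apply/cvgrPdist_lt => e /(cell_dos_left a)[b ba be].
near=> x.
have xa : x < a by near: x; exact: nbhs_left_lt.
have bx : b <= x by near: x; exact: nbhs_left_ge.
have h1 := cell_dos_jump_le xa; have h2 := cell_dos_mono bx.
by rewrite ltr_norml; apply/andP; split; lra.
Unshelve. all: by end_near. Qed.

Lemma cell_dos_continuous (a : R) : a != 3 / 2 -> cell_dos x @[x --> a] --> cell_dos a.
Proof.
move=> a32; have m0 := eigen_mass_eq0 ik ki spec a32.
apply/cvgrPdist_lt => e e0.
have [b ab be] := cell_dos_right a e0.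
have [b' ba be'] := cell_dos_left a e0.
near=> x.
have /andP[bx xb] : b' < x < b.
  have : x \in `]b', b[ by near: x; apply: near_in_itvoo; rewrite in_itv/= ba ab.
  by rewrite in_itv.
have h1 := cell_dos_mono (ltW bx); have h2 := cell_dos_mono (ltW xb).
rewrite m0 in be'; rewrite ltr_norml; apply/andP; split; lra.
Unshelve. all: by end_near. Qed.

Lemma cell_dos_jump : has_jump cell_dos (3 / 2) (1 / 3).
Proof.
have m1 : mass (3 / 2) = 1.
  apply/eqP; rewrite eq_le (eigen_mass_flat_le ik ki spec).
  exact: (eigen_mass_flat_ge ik ki spec).
exists (cell_dos (3 / 2) - 3^-1 * mass (3 / 2)), (cell_dos (3 / 2)); split.
- exact: cell_dos_cvg_left.
- exact: cell_dos_cvg_right.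
- by rewrite m1; field.
Qed.

(** At 0 itself the value is the left limit plus the jump there, and 0 is not the energy of the flat
    band. *)
Lemma cell_dos_le0 x : x <= 0 -> cell_dos x = 0.
Proof.
have neg y : y < 0 -> cell_dos y = 0.
  move=> y0; rewrite /cell_dos big1 ?mulr0// => k _.
  by rewrite /spectral_cdf (pvm_neg opA spec)// rip0r.
have pos y : 0 <= cell_dos y.
  by rewrite mulr_ge0// sumr_ge0// => k _; apply: (rip_pvm_ge0 pvmP).
rewrite le_eqVlt => /predU1P[->|]; last exact: neg.
apply/eqP; rewrite eq_le pos andbT; apply/ler_addgt0Pr => e e0.
have [b b0] := cell_dos_left 0 e0.
rewrite (neg b b0) (eigen_mass_eq0 ik ki spec); last by apply/eqP; lra.
lra.
Qed.

(** Above 3/2 the form bound [tri_lap_le] leaves no spectrum; the value at 3/2 follows by right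
    continuity. *)
Lemma cell_dos_ge x : 3 / 2 <= x -> cell_dos x = 1.
Proof.
have cdf_le1 k y : cdf (delta (iota (0, 0, k))) y <= 1.
  apply: le_trans (rip_pvm_le pvmP _ (dk k)) _ => //.
  by rewrite rip_delta deltaE eqxx.
have le1 y : cell_dos y <= 1.
  rewrite /cell_dos sum_corner; have := cdf_le1 Ca y; have := cdf_le1 Cb y.
  have := cdf_le1 Cc y; lra.
have big y : 3 / 2 < y -> cell_dos y = 1.
  move=> y32; rewrite /cell_dos sum_corner.
  have one k : cdf (delta (iota (0, 0, k))) y = 1.
    have my : measurable `]y, +oo[%classic by exact: measurable_itv.
    rewrite /spectral_cdf (pvm_le_id spec (dk k)) ?rip_delta ?deltaE ?eqxx//.
    set G := P _ _; have hG : ell2 G by exact: (pvm_ell2 pvmP).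
    apply: rip_eq0 => //.
    have sub : `]y, +oo[%classic `<=` [set z | y <= z].
      by move=> z /=; rewrite in_itv/= andbT => /ltW.
    have := form_ge spec my hG (pvm_idem pvmP my (dk k)) sub.
    move=> /le_trans/(_ (tri_lap_le (tup3 ik ki) (tdn3 ik ki) hG)).
    rewrite -subr_ge0 -mulrBl nmulr_rge0 ?subr_lt0// => h.
    by apply/eqP; rewrite eq_le h rip_ge0.
  by rewrite !one; field.
rewrite le_eqVlt => /predU1P[<-|]; last exact: big.
apply/eqP; rewrite eq_le le1; apply/ler_addgt0Pr => e e0.
have [b b32] := cell_dos_right (3 / 2) e0.
by rewrite (big b b32) => /ltW.
Qed.

Lemma cell_dos_strict x y : 0 <= x -> x < y -> y <= 3 / 2 -> cell_dos x < cell_dos y.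
Proof.
move=> x0 xy y32.
have [k lk] := spectral_cdf_strict ik ki spec x0 xy y32.
rewrite ltr_pM2l// (bigD1 k)//= [ltRHS](bigD1 k)//=.
apply: ltr_leD => //; apply: ler_sum => k' _.
exact: (spectral_cdf_mono spec (dk k') (ltW xy)).
Qed.

End DensityOfStates.

(** The norm form of the Eisenstein integers takes the value 1 at the six units only; this linear
    description of them lets linear arithmetic settle the adjacency cases. *)
Lemma hexagonal_units (p q : int) : p ^+ 2 + p * q + q ^+ 2 = 1 ->
  [/\ ~ (p = 0 /\ q = 0), -1 <= p <= 1, -1 <= q <= 1 & -1 <= p + q <= 1].
Proof. by move=> h; split; [nia|apply/andP; split; nia..]. Qed.

(** * Geometry of the Kagome lattice in the complex plane *)

Section Kagome.
Context {R : realType}.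
Local Notation Re := complex.Re.
Local Notation Im := complex.Im.

(** The triple angle formula at x = pi / 3 factors as (c + 1) (2 c - 1)^2 = 0, and c > 0. *)
Lemma cos_pi3 : cos (pi / 3 : R) = 1 / 2.
Proof.
set x : R := pi / 3; set c := cos x.
have pi0 : (0 : R) < pi := pi_gt0 R.
have c0 : 0 < c.
  by apply: cos_gt0_pihalf; rewrite /x; apply/andP; split; lra.
have s2 : sin x ^+ 2 = 1 - c ^+ 2 by rewrite -(cos2Dsin2 x) addrC addKr.
have : cos (x + x + x) = -1.
  by rewrite -[RHS](@cospi R); congr cos; rewrite /x; field.
rewrite !cosD sinD -/c => e.
have e' : (c + 1) * (2 * c - 1) ^+ 2 = 0.
  have : c * c * c - 3 * c * sin x ^+ 2 = - 1 by rewrite -e; ring.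
  by rewrite s2 => h; lra.
move/eqP : e'; rewrite mulf_eq0 sqrf_eq0 => /orP[|] /eqP; lra.
Qed.

Lemma sin_pi3_sqr : sin (pi / 3 : R) ^+ 2 = 3 / 4.
Proof.
have := cos2Dsin2 (pi / 3 : R); rewrite cos_pi3 => h; lra.
Qed.

Let S : R := sin (pi / 3).

(** Integer coordinates in the basis [w1], [w2]. Their parities tell the corners apart, and both odd
    does not occur. *)
Let coord1 (v : cell_site) : int := let: (x, y, k) := v in
  2 * x + (if k is Cb then 1 else 0).
Let coord2 (v : cell_site) : int := let: (x, y, k) := v in
  2 * y + (if k is Cc then 1 else 0).

Definition corner_pos (k : corner) : R[i] :=
  match k with Ca => 0 | Cb => w1 R | Cc => w2 R end.

Definition site_pos (v : cell_site) : R[i] := translate v.1 (corner_pos v.2).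

Lemma site_posE v : site_pos v =
  (((coord1 v)%:~R + (coord2 v)%:~R / 2) +i* ((coord2 v)%:~R * S))%C.
Proof.
have w2E : w2 R = (1 / 2 +i* S)%C by rewrite /w2 cos_pi3.
have intE (z : int) : z%:~R = (z%:~R +i* 0)%C :> R[i].
  exact: (esym (rmorph_int (real_complex R) z)).
have e2 : 2 = (2 +i* 0)%C :> R[i] by exact: (esym (rmorph_nat (real_complex R) 2)).
have e1 : 1 = (1 +i* 0)%C :> R[i] by [].
case: v => [[x y] k]; rewrite /site_pos /translate /= /w1 w2E !intE e2.
by case: k => /=; rewrite ?w2E /w1 ?e1 !rmorphD !rmorphM /=; congr (_ +i* _)%C; field.
Qed.

Lemma site_pos_inj : injective site_pos.
Proof.
have S0 : S != 0.
  apply/negP => /eqP S0; have := sin_pi3_sqr; rewrite -/S S0 expr0n /=; lra.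
move=> v v' e; have := congr1 (fun z : R[i] => complex.Im z) e.
rewrite !site_posE /= => /(mulIf S0)/eqP; rewrite eqr_int => /eqP e2.
have := congr1 (fun z : R[i] => complex.Re z) e.
rewrite !site_posE /= e2 => /addIr/eqP; rewrite eqr_int => /eqP e1.
move: e => _.
case: v v' e1 e2 => [[x y] k] [[x' y'] k']; rewrite /coord1 /coord2.
case: k; case: k' => e1 e2; try by exfalso; lia.
all: have -> : x = x' by lia.
all: by have -> : y = y' by lia.
Qed.

Lemma site_dist v v' : (`|site_pos v - site_pos v'| = 1) <->
  ((coord1 v - coord1 v') ^+ 2 + (coord1 v - coord1 v') * (coord2 v - coord2 v') +
   (coord2 v - coord2 v') ^+ 2 = 1).
Proof.
set p := coord1 v - coord1 v'; set q := coord2 v - coord2 v'.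
have zE : site_pos v - site_pos v' = ((p%:~R + q%:~R / 2) +i* (q%:~R * S))%C.
  by rewrite !site_posE /p /q !rmorphB /=; congr (_ +i* _)%C; field.
have nE : `|site_pos v - site_pos v'| ^+ 2 = (p ^+ 2 + p * q + q ^+ 2)%:~R.
  clearbody p q; rewrite zE -add_Re2_Im2 /= exprMn sin_pi3_sqr.
  rewrite -(rmorph_int (real_complex R)); congr (_%:C)%C.
  by rewrite !rmorphD !rmorphM /= ?rmorphXn /=; field.
split=> [h|h].
  by move: nE; rewrite h expr1n => /esym/eqP; rewrite -[1]/(1%:~R) eqr_int => /eqP.
by move: nE; rewrite h => /eqP; rewrite sqrp_eq1// => /eqP.
Qed.

(** Of the six points of the triangular lattice at distance 1, two have both coordinates odd and are
    not vertices; the other four are the images under the two rotations and their squares. *)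
Lemma adjacent_sites v v' : (`|site_pos v - site_pos v'| = 1) <->
  v' \in [:: up v; up (up v); dn v; dn (dn v)].
Proof.
rewrite site_dist !inE; split; last first.
  by case: v => [[x y] []] /or4P[] /eqP -> /=; rewrite /coord1 /coord2; lia.
move=> /hexagonal_units.
case: v v' => [[x y] k] [[x' y'] k']; rewrite /coord1 /coord2.
have siteE (a b a' b' : int) : a = a' -> b = b' -> forall l, (a, b, l) == (a', b', l) :> cell_site.
  by move=> -> ->.
case: k; case: k' => -[pq /andP[p1 p2] /andP[q1 q2] /andP[r1 r2]];
  rewrite /up /dn; try by exfalso; lia.
all: apply/or4P; have [xx|xx] := eqVneq x' x; have [yy|yy] := eqVneq y' y.
all: solve [exfalso; lia | apply: Or41; apply: siteE; lia | apply: Or42; apply: siteE; lia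
  | apply: Or43; apply: siteE; lia | apply: Or44; apply: siteE; lia].
Qed.

Lemma neighbours_uniq v : uniq [:: up v; up (up v); dn v; dn (dn v)].
Proof.
have ne : ((Ca == Cb) = false) * ((Cb == Ca) = false) * ((Ca == Cc) = false) *
  ((Cc == Ca) = false) * ((Cb == Cc) = false) * ((Cc == Cb) = false) by [].
by case: v => [[x y] []]; rewrite /up /dn /= !inE !xpair_eqE !ne !eqxx; lia.
Qed.

Lemma site_pos_kagome v : site_pos v \in kagome R.
Proof.
rewrite inE; case: v => [[x y] k]; rewrite /site_pos /kagome /=.
by case: k; [left; left|left; right|right]; exists (x, y).
Qed.

Definition site (v : cell_site) : kagome R := exist _ (site_pos v) (site_pos_kagome v).

Lemma site_inj : injective site.
Proof. by move=> v v' /(congr1 val); exact: site_pos_inj. Qed.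

Lemma site_surj (t : kagome R) : exists v, site v = t.
Proof.
have := valP t; rewrite inE => -[[|]|] [[x y] _ e].
- by exists (x, y, Ca); apply: val_inj; rewrite -e.
- by exists (x, y, Cb); apply: val_inj; rewrite -e.
- by exists (x, y, Cc); apply: val_inj; rewrite -e.
Qed.

Definition site_index (t : kagome R) : cell_site := projT1 (cid (site_surj t)).

Lemma site_indexK : cancel site_index site.
Proof. by move=> t; rewrite /site_index; case: cid. Qed.

Lemma siteK : cancel site site_index.
Proof. by move=> v; apply: site_inj; rewrite site_indexK. Qed.

Lemma nbrs_site v : nbrs (site v) =
  [set` [:: site (up v); site (up (up v)); site (dn v); site (dn (dn v))]].
Proof.
apply/seteqP; split=> w; rewrite -(site_indexK w); set v' := site_index w.
  rewrite /nbrs /= => /adjacent_sites; rewrite !inE !(inj_eq site_inj).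
  by [].
rewrite /= !inE !(inj_eq site_inj) => h.
by apply/adjacent_sites; rewrite !inE.
Qed.

Lemma neighbour_sites_uniq v :
  uniq [:: site (up v); site (up (up v)); site (dn v); site (dn (dn v))].
Proof.
by rewrite -[[:: _; _; _; _]]/(map site [:: up v; up (up v); dn v; dn (dn v)])
  (map_inj_uniq site_inj) neighbours_uniq.
Qed.

Lemma deg_site v : deg (site v) = 4%N.
Proof.
rewrite /deg nbrs_site; have u := neighbour_sites_uniq v.
set s := [:: _; _; _; _] in u *.
have -> : [set` s] = [set` [fset x in s]%fset].
  by apply/seteqP; split=> x /=; rewrite in_fset.
by rewrite set_fsetK card_fseq undup_id.
Qed.

Lemma laplacianE : @laplacian R = tri_lap (tup site site_index) (tdn site site_index).
Proof.
apply/funext => F; apply/funext => t; rewrite -(site_indexK t); set v := site_index t.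
rewrite /laplacian /tri_lap !(tup_iota siteK) !(tdn_iota siteK) deg_site nbrs_site.
rewrite -fsbig_seq; last exact: neighbour_sites_uniq.
by rewrite !big_cons big_nil /=; field.
Qed.

(** * From a fundamental domain to the three corners of one cell *)

Section FundamentalDomain.
Context (Q : set (kagome R)) (FD : fundamental_domain Q).
Context {P : set R -> (kagome R -> R[i]) -> kagome R -> R[i]}
  (spec : is_spectral_measure (@laplacian R) P).

Lemma same_orbit v t : (exists g : int * int, val (site v) = translate g (val t)) <->
  (site_index t).2 = v.2.
Proof.
rewrite -[t]site_indexK siteK; move: (site_index t) => w.
have vs v' : val (site v') = site_pos v' by [].
rewrite !vs.
have tr (g : int * int) : translate g (site_pos w) = site_pos (cell_shift g.1 g.2 w).
  by case: w => [[x y] k]; rewrite /= /site_pos /translate /= !rmorphD /=; ring.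
split=> [[g]|].
  by rewrite tr => /site_pos_inj ->; case: (w) => [[x y] k].
move: tr; case: v => [[x y] k]; case: w => [[x' y'] k'] tr /= <-.
by exists (x - x', y - y'); rewrite tr /= !subrKC.
Qed.

(** Orbits are the classes of corners, so [Q] consists of one vertex [qk k] of each class. Each is a
    translate of the vertex of its class in the cell at the origin, so by invariance the choice of
    [Q] disappears from the trace. *)
Lemma ids_cell_dos mu : ids Q P mu = cell_dos site (P := P) mu.
Proof.
have q k : exists2 t, Q t & (site_index t).2 = k.
  have [t [[Qt /same_orbit e] _]] := FD (site (0, 0, k)).
  by exists t.
pose qk k := s2val (cid2 (q k)).
have Qq k : Q (qk k) by rewrite /qk; case: cid2.
have qkE k : (site_index (qk k)).2 = k by rewrite /qk; case: cid2.
have qE t : Q t -> t = qk (site_index t).2.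
  move=> Qt; have [t' [_ tu]] := FD t.
  have e u : Q u -> (site_index u).2 = (site_index t).2 -> t' = u.
    move=> Qu ue; apply: tu; split=> //; rewrite -{1}(site_indexK t).
    exact/same_orbit.
  exact: etrans (esym (e t Qt erefl)) (e _ (Qq _) (qkE (site_index t).2)).
have qk_inj : injective qk by move=> k k' /(congr1 (fun t => (site_index t).2)); rewrite !qkE.
pose X := [fset x in map qk (enum {: corner})]%fset.
have XE : Q = [set` X].
  apply/seteqP; split=> t /=; rewrite in_fset.
    by move=> /qE ->; apply: map_f; rewrite mem_enum.
  by move=> /mapP[k _ ->].
have Xu : uniq (map qk (enum {: corner})) by rewrite map_inj_uniq// enum_uniq.
rewrite /ids /cell_dos XE set_fsetK card_fseq undup_id// size_map -cardE card_corner.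
congr (_ * _).
have termE t : complex.Re (inner \1_[set t] (mul_indic [set` X] (P `]-oo, mu]%classic \1_[set t]))) =
    (t \in X)%:R * spectral_cdf (P := P) (delta t) mu.
  rewrite Re_inner -/(delta t) rip_delta /mul_indic indicE.
  rewrite (_ : (t \in [set` X]) = (t \in X)); last by apply/idP/idP => [/set_mem|/mem_set].
  rewrite /spectral_cdf rip_delta.
  by case: (t \in X); rewrite ?mul1r ?mul0r.
transitivity (rsum (fun t => (t \in X)%:R * spectral_cdf (P := P) (delta t) mu)).
  exact: (congr1 (@rsum R _) (funext termE)).
rewrite (@rsum_support _ _ X); last by move=> t /negbTE ->; rewrite mul0r.
transitivity (\sum_(t <- X) spectral_cdf (P := P) (delta t) mu).
  by apply: eq_big_seq => t ->; rewrite mul1r.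
rewrite (perm_big (map qk (enum {: corner}))) /=; last first.
  apply: uniq_perm => //; first exact: fset_uniq.
  by move=> t; rewrite in_fset.
rewrite big_map big_enum; apply: eq_bigr => k _.
have := qkE k; have := site_indexK (qk k).
case: (site_index (qk k)) => [[x y] k'] <- /= ->.
move: (spec); rewrite laplacianE => spec'.
exact: (kagome_cdf_shift siteK site_indexK spec').
Qed.

End FundamentalDomain.
End Kagome.

Theorem proposition3p3 (R : realType) (Q : set (kagome R))
    (P : set R -> (kagome R -> R[i]) -> kagome R -> R[i]) :
  fundamental_domain Q ->
  is_spectral_measure (@laplacian R) P ->
  [/\ forall mu : R, mu <= 0 -> ids Q P mu = 0,
      forall mu : R, mu != 3 / 2 -> {for mu, continuous (ids Q P)},
      has_jump (ids Q P) (3 / 2) (1 / 3),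
      forall x y : R, 0 <= x -> x < y -> y <= 3 / 2 -> ids Q P x < ids Q P y
    & forall mu : R, 3 / 2 <= mu -> ids Q P mu = 1].
Proof.
move=> FD spec.
have -> : ids Q P = cell_dos site (P := P).
  by apply/funext => mu; exact: ids_cell_dos.
rewrite laplacianE in spec.
split.
- by move=> mu; exact: (cell_dos_le0 siteK site_indexK spec).
- by move=> mu; exact: (cell_dos_continuous siteK site_indexK spec).
- exact: (cell_dos_jump siteK site_indexK spec).
- by move=> x y; exact: (cell_dos_strict siteK site_indexK spec).
- by move=> mu; exact: (cell_dos_ge siteK site_indexK spec).
Qed.
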